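(* For all $\varepsilon > 0$ and $\mu > 2$, there exists an integer $N$ such that the following holds. If $G$ is a (finite, simple) graph on at least $N$ vertices with average degree at least $\mu$, and $H$ is a random spanning subgraph of $G$ formed by including each edge of $G$ independently with probability $p$, where $p \ge \tfrac{1}{\mu-1} + \varepsilon$ (and $p\le 1$), then $H$ contains a circuit (cycle) with probability at least $1-\varepsilon$.
   Context: All graphs are finite and simple. A circuit is a cycle of the graph. *)

(* Defs.v *)
From HB Require Import structures.
From mathcomp Require Import all_boot all_order all_algebra.
From mathcomp Require Import boolp reals.

Set Implicit Arguments.
Unset Strict Implicit.
Unset Printing Implicit Defensive.

Import Order.TTheory GRing.Theory Num.Theory.
Local Open Scope ring_scope.

(* A finite simple graph is a symmetric irreflexive relation [g] on a finite
   vertex type [V]. *)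
Section Graph.
Variables (V : finType) (g : rel V).

Definition deg (x : V) : nat := #|[set y | g x y]|.

Definition average_degree (R : realType) : R :=
  (\sum_(x : V) (deg x)%:R) / #|V|%:R.

(* An edge is the two-element set of its endpoints. *)
Definition edges : {set {set V}} := [set [set z.1; z.2] | z : V * V & g z.1 z.2].

(* The bound on the size excludes the degenerate sequences [:: x; y], which
   satisfy [cycle g] whenever x and y are adjacent, and [::]. *)
Definition contains_circuit : Prop :=
  exists c : seq V, [/\ (3 <= size c)%N, uniq c & cycle g c].

End Graph.

Definition spanning_subgraph (V : finType) (F : {set {set V}}) : rel V :=
  fun x y => [set x; y] \in F.

Section RandomSubgraph.
Variables (R : realType) (V : finType) (g : rel V) (p : R).

(* The product Bernoulli(p) law on the subsets of the edge set of [g]. *)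
Definition subgraph_weight (F : {set {set V}}) : R :=
  \prod_(e in edges g) (if e \in F then p else 1 - p).

Definition subgraph_prob (A : rel V -> Prop) : R :=
  \sum_(F in powerset (edges g) | `[< A (spanning_subgraph F) >])
    subgraph_weight F.

End RandomSubgraph.

(* Main.v *)
(* Colour every edge independently: closed with probability 1 - p, first round
   with probability p1 slightly above 1 / (mu - 1), second round with the remaining
   probability.  If G has many edge-disjoint short circuits, one of them is open
   with high probability; otherwise deleting boundedly many edges makes the girth
   large.  Splitting the vertices of high degree and passing to a dense subgraph
   gives a graph h of bounded degree, minimum degree at least 2 and average degree
   at least m with p1 (m - 1) > 1.  Acyclicity of H is inherited in the form "every
   nonempty vertex set contains a vertex with at most one neighbour inside it".

   Let s_k(u,v) be the probability that a first-round walk of length k leaves v away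
   from u, and y_k(u,v) the expected number of open edges vw with w <> u that
   continue to such a walk, so that s_{k+1} is the probability that this number is
   positive.  Averaging ln y_k over the darts (u,v), Jensen's inequality and the
   convexity of x ln (x - 1) give that ln (y_k / s_{k+1}) averages at least
   eta = ln (p1 (m - 1)) > 0: branching is unavoidable.  Now y_k - s_{k+1} is at most
   a sum over pairs of disjoint arms at v, whence the sum over the darts (v,w) of
   s_k(v,w) s_k(w,v) is at least a positive fraction, independent of k, of the
   number of darts.

   Hence the expected number X of second-round edges with a first-round arm of
   length k at both ends is linear in the size of h, with a constant independent
   of k, and X is concentrated by Chebyshev's inequality since it is a sum of local
   variables.  But if the open graph is a forest, contracting the first-round
   components shows that the second-round edges joining components of size at
   least k number at most n / k, which is impossible for k large. *)

Require Import Defs.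
From HB Require Import structures.
From mathcomp Require Import all_boot all_order all_algebra.
From mathcomp Require Import boolp reals normedtype derive realfun exp.
From mathcomp Require Import ring lra zify.

Set Implicit Arguments.
Unset Strict Implicit.
Unset Printing Implicit Defensive.

Import Order.TTheory GRing.Theory Num.Theory.
Import numFieldNormedType.Exports.
Local Open Scope ring_scope.

(** * Product measures on finite spaces: independence and variance *)

Section ProductMeasure.
Variables (R : realFieldType) (L C : finType) (a : C -> R).
Hypothesis a_ge0 : forall c, 0 <= a c.
Hypothesis a_sum1 : \sum_c a c = 1.

Local Notation Omega := {ffun L -> C}.
Implicit Types (om : Omega) (f : Omega -> R) (S : {set L}).

Definition weight om : R := \prod_l a (om l).
Definition expect f : R := \sum_om weight om * f om.

Lemma weight_ge0 om : 0 <= weight om.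
Proof. exact: prodr_ge0. Qed.

Lemma weight_sum (Q : L -> pred C) :
  \sum_(om in family Q) weight om = \prod_l \sum_(c | Q l c) a c.
Proof. by rewrite bigA_distr_big_dep. Qed.

Lemma expect_cst x : expect (fun=> x) = x.
Proof.
rewrite /expect -mulr_suml; set s := \sum_om _; suff -> : s = 1 by rewrite mul1r.
rewrite /s (eq_bigl (fun om => om \in family (fun=> xpredT))); last first.
  by move=> om; apply/esym/familyP.
by rewrite weight_sum big1.
Qed.

Lemma eq_expect f1 f2 : f1 =1 f2 -> expect f1 = expect f2.
Proof. by move=> eqf; apply: eq_bigr => om _; rewrite eqf. Qed.

Lemma le_expect f1 f2 : (forall om, f1 om <= f2 om) -> expect f1 <= expect f2.
Proof. by move=> lef; apply: ler_sum => om _; rewrite ler_wpM2l ?weight_ge0. Qed.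

Lemma expectD f1 f2 : expect (fun om => f1 om + f2 om) = expect f1 + expect f2.
Proof. by rewrite -big_split; apply: eq_bigr => om _; rewrite mulrDr. Qed.

Lemma expectZ x f : expect (fun om => x * f om) = x * expect f.
Proof. by rewrite /expect big_distrr; apply: eq_bigr => om _; rewrite mulrCA. Qed.

Lemma expectB f1 f2 : expect (fun om => f1 om - f2 om) = expect f1 - expect f2.
Proof.
rewrite -mulN1r -expectZ -expectD; apply: eq_expect => om; by rewrite mulN1r.
Qed.

Lemma expect_sum (I : Type) (r : seq I) (P : pred I) (F : I -> Omega -> R) :
  expect (fun om => \sum_(i <- r | P i) F i om) = \sum_(i <- r | P i) expect (F i).
Proof.
rewrite /expect exchange_big; apply: eq_bigr => om _.
by rewrite big_distrr.
Qed.

Definition depends_on (T : Type) S (f : Omega -> T) :=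
  forall om om' : Omega, {in S, om =1 om'} -> f om = f om'.

Lemma depends_onS (T : Type) S S' (f : Omega -> T) :
  S \subset S' -> depends_on S f -> depends_on S' f.
Proof. by move=> /subsetP sSS' df om om' eqom; apply: df => l /sSS'/eqom. Qed.

Definition resample S om om' : Omega := [ffun l => if l \in S then om l else om' l].

(* Swapping the coordinates outside S between two independent samples is a
   weight-preserving involution of the product space. *)
Lemma expect_resample S (F : Omega -> Omega -> R) :
  \sum_om \sum_om' weight om * weight om' * F om om' =
  \sum_om \sum_om' weight om * weight om' * F (resample S om om') (resample S om' om).
Proof.
rewrite !pair_bigA /=.
pose h (z : Omega * Omega) := (resample S z.1 z.2, resample S z.2 z.1).
have hK : involutive h.
  move=> [om om']; congr (_, _); apply/ffunP => l; rewrite !ffunE /=;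
  by case: (l \in S).
rewrite (reindex_inj (inv_inj hK)) /=; apply: eq_bigr => -[om om'] _ /=.
congr (_ * _); rewrite /weight -!big_split /=; apply: eq_bigr => l _.
by rewrite !ffunE; case: ifP => _ //; rewrite mulrC.
Qed.

(** Take two independent samples and swap their coordinates outside [S]: [f1] then reads only the
    first sample and [f2] only the second, so the double sum factorises. *)
Lemma expect_indep S S' f1 f2 : depends_on S f1 -> depends_on S' f2 ->
  [disjoint S & S'] -> expect (fun om => f1 om * f2 om) = expect f1 * expect f2.
Proof.
move=> d1 d2 dis; rewrite {2 3}/expect big_distrlr /=.
rewrite -[LHS]mulr1 -(expect_cst 1) big_distrlr /=.
under eq_bigr do under eq_bigr do rewrite mulrACA mulr1.
rewrite (expect_resample S (fun om om' => f1 om * f2 om)).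
apply: eq_bigr => om _; apply: eq_bigr => om' _; rewrite [RHS]mulrACA.
congr (_ * (_ * _)); first by apply: d1 => l lS; rewrite ffunE lS.
apply: d2 => l lS'; rewrite ffunE ifN //.
by rewrite (disjointFl dis lS').
Qed.

Lemma depends_on_prod (I : eqType) (r : seq I) (F : I -> Omega -> R) S :
  {in r, forall i, depends_on S (F i)} -> depends_on S (fun om => \prod_(i <- r) F i om).
Proof.
move=> dF om om' eqom; rewrite big_seq [RHS]big_seq.
by apply: eq_bigr => i /dF; apply.
Qed.

Lemma expect_prod (I : finType) (r : seq I) (F : I -> Omega -> R) (D : I -> {set L}) :
  uniq r -> {in r, forall i, depends_on (D i) (F i)} ->
  {in r &, forall i j, i != j -> [disjoint D i & D j]} ->
  expect (fun om => \prod_(i <- r) F i om) = \prod_(i <- r) expect (F i).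
Proof.
elim: r => [|i r IHr] /= => [_ _ _|/andP[ir ur] dF dis].
  by under eq_expect do rewrite big_nil; rewrite expect_cst big_nil.
rewrite big_cons -IHr //; first last.
- by move=> j k jr kr; apply: dis; rewrite inE ?jr ?kr orbT.
- by move=> j jr; apply: dF; rewrite inE jr orbT.
under eq_expect do rewrite big_cons.
apply: (@expect_indep (D i) (\bigcup_(j <- r) D j)).
- by apply: dF; rewrite mem_head.
- apply: depends_on_prod => j jr; apply: depends_onS (dF j _).
    by rewrite bigcup_seq (bigcup_sup j).
  by rewrite inE jr orbT.
- rewrite bigcup_seq; apply: bigcup_disjoint => j jr.
  apply: dis; rewrite ?inE ?eqxx ?jr ?orbT //.
  by apply: contraNneq ir => ->.
Qed.

Lemma expect_coord l (F : C -> R) : expect (fun om => F (om l)) = \sum_c a c * F c.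
Proof.
(* The value [F] is absorbed into the factor of coordinate [l], so that the sum over all samples
   becomes a product of sums. *)
pose G l' c := if l' == l then a c * F c else a c.
transitivity (\prod_l' \sum_c G l' c).
  rewrite bigA_distr_bigA; apply: eq_bigr => om _.
  rewrite /weight (bigD1 l) //= [RHS](bigD1 l) //= {1}/G eqxx -!mulrA.
  congr (_ * _); rewrite mulrC; congr (_ * _).
  by apply: eq_bigr => l' /negbTE nl; rewrite /G nl.
rewrite (bigD1 l) //= [X in _ * X]big1 ?mulr1; last first.
  by move=> l' /negbTE nl; rewrite -[RHS]a_sum1; apply: eq_bigr => c _; rewrite /G nl.
by apply: eq_bigr => c _; rewrite /G eqxx.
Qed.

Lemma chebyshev_lower (X : Omega -> R) (A : pred Omega) t v : 0 < t ->
  (forall om, A om -> X om <= expect X - t) ->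
  expect (fun om => (X om - expect X) ^+ 2) <= v ->
  expect (fun om => (A om)%:R) <= v / t ^+ 2.
Proof.
move=> t0 AX varX; rewrite ler_pdivlMr ?exprn_gt0 // mulrC -expectZ.
apply: le_trans varX; apply: le_expect => om.
case Aom: (A om); last by rewrite mulr0 sqr_ge0.
by rewrite mulr1; have := AX _ Aom; nra.
Qed.

(** Expanding the square gives a sum of covariances. Pairs with disjoint dependency sets are
    independent and contribute 0; any other pair contributes at most 1, because all values lie in
    [0, 1]. *)
Lemma variance_sum_le (I : finType) (P : {set I}) (Y : I -> Omega -> R)
    (D : I -> {set L}) X :
  X =1 (fun om => \sum_(i in P) Y i om) ->
  {in P, forall i, depends_on (D i) (Y i)} ->
  {in P, forall i om, 0 <= Y i om <= 1} ->
  expect (fun om => (X om - expect X) ^+ 2) <=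
  (\sum_(i in P) #|[set j in P | ~~ [disjoint D i & D j]]|)%:R.
Proof.
move=> XE dY Y01.
have -> : expect (fun om => (X om - expect X) ^+ 2) =
    expect (fun om => X om * X om) - expect X * expect X.
  rewrite (eq_expect (f2 := fun om => (X om * X om - (2 * expect X) * X om) + expect X ^+ 2)).
    rewrite expectD expectB expectZ expect_cst; ring.
  by move=> om; ring.
have -> : expect (fun om => X om * X om) =
    \sum_(i in P) \sum_(j in P) expect (fun om => Y i om * Y j om).
  under eq_expect do rewrite XE big_distrlr.
  by rewrite expect_sum; apply: eq_bigr => i _; rewrite expect_sum.
rewrite (eq_expect XE) expect_sum big_distrlr /= -sumrB natr_sum ler_sum // => i iP.
rewrite -sumrB -sum1_card natr_sum big_mkcond [leRHS]big_mkcond /=.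
apply: ler_sum => j _; rewrite inE; case: ifP => // jP /=.
have [dis|_] := boolP [disjoint D i & D j].
  by rewrite (expect_indep (dY _ iP) (dY _ jP) dis) subrr.
have E0 k : k \in P -> 0 <= expect (Y k).
  move=> kP; rewrite -(expect_cst 0); apply: le_expect => om.
  by case/andP: (Y01 _ kP om).
have : expect (fun om => Y i om * Y j om) <= 1.
  rewrite -[leRHS](expect_cst 1); apply: le_expect => om.
  have /andP[? ?] := Y01 _ iP om; have /andP[? ?] := Y01 _ jP om; nra.
have := E0 _ iP; have := E0 _ jP; nra.
Qed.

End ProductMeasure.

(** * Forests: degeneracy and edge counts *)

Section Forests.
Local Open Scope nat_scope.
Variables (V : finType).
Implicit Types (e : rel V) (S Q : {set V}).

(** Acyclicity as 1-degeneracy, a form that passes directly to graphs obtained by splitting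
    vertices. *)
Definition leafy e := forall S, S != set0 ->
  exists2 x, x \in S & #|[set y in S | e x y]| <= 1.

(** If every vertex of [S] had two neighbours in [S], a simple path in [S] could always be prolonged
    at its head, since a return to the path would close a circuit; but a simple path has at most
    #|V| vertices. *)
Lemma no_circuit_leafy e : symmetric e -> irreflexive e ->
  ~ contains_circuit e -> leafy e.
Proof.
move=> sym_e irr_e nocirc S /set0Pn[x0 x0S]; apply: contrapT => noleaf.
have two x y : x \in S -> exists z, [/\ z \in S, e x z & z != y].
  move=> xS; have /card_gt1P[z [z' []]] : 1 < #|[set y in S | e x y]|.
    by rewrite ltnNge; apply/negP => le1; apply: noleaf; exists x.
  rewrite !inE => /andP[zS ez] /andP[z'S ez'] neq.
  have [zy|] := eqVneq z y; last by exists z.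
  by exists z'; rewrite z'S ez' -zy eq_sym.
pose walk n := exists x s, [/\ size s = n, uniq (x :: s), path e x s & {subset x :: s <= S}].
have grow n : walk n -> walk n.+1.
  case=> x [s [<- us ps sS]].
  (* The new vertex avoids the successor of [x], so a return to the path closes a circuit with at
     least three vertices. For a one-vertex path the default is [x] itself, which is no neighbour of
     [x]. *)
  have [y [yS exy yh]] := two x (head x s) (sS x (mem_head _ _)).
  have eyx : e y x by rewrite sym_e.
  have [/splitPr ys|ys] := boolP (y \in s); last first.
    exists y, (x :: s); split => //=.
    - rewrite -/(uniq (x :: s)) us inE negb_or ys !andbT.
      by apply: contraTneq exy => ->; rewrite irr_e.
    - by rewrite eyx.
    - by move=> z; rewrite inE => /orP[/eqP->|/sS].
  case: ys => s1 s2 in us ps sS yh *; exfalso; apply: nocirc.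
  exists (x :: rcons s1 y); split.
  - by case: s1 yh {us ps sS} => [|z s1] /=; rewrite ?eqxx ?size_rcons.
  - by move: us; rewrite -cat_rcons -cat_cons cat_uniq => /and3P[].
  - rewrite /= rcons_path last_rcons eyx andbT.
    by move: ps; rewrite -cat_rcons cat_path => /andP[].
have walks n : walk n.
  elim: n => [|n]; last exact: grow.
  by exists x0, [::]; split=> // z; rewrite inE => /eqP->.
have [x [s [szs us _ _]]] := walks #|V|.
by have := max_card (mem (x :: s)); rewrite (card_uniqP us) /= szs ltnn.
Qed.

Definition inner_darts e S := \sum_(x in S) #|[set y in S | e x y]|.

Lemma inner_dartsU1 e S x : symmetric e -> irreflexive e -> x \notin S ->
  inner_darts e (x |: S) = inner_darts e S + 2 * #|[set y in S | e x y]|.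
Proof.
move=> sym_e irr_e xS; rewrite /inner_darts big_setU1 //=.
have -> : [set y in x |: S | e x y] = [set y in S | e x y].
  by apply/setP => y; rewrite !inE; case: eqVneq => // ->; rewrite irr_e !andbF.
rewrite addnC mul2n -addnn addnA; congr (_ + _).
rewrite -sum1dep_card big_mkcondr /= -big_split; apply: eq_bigr => y yS /=.
rewrite sym_e; case exy: (e y x); last first.
  rewrite addn0; apply: eq_card => z; rewrite !inE; case: eqVneq => // ->.
  by rewrite exy !andbF.
have -> : [set z in x |: S | e y z] = x |: [set z in S | e y z].
  by apply/setP => z; rewrite !inE; case: eqVneq => // ->; rewrite exy.
by rewrite cardsU1 inE (negbTE xS) addnC.
Qed.

(** A leaf accounts for at most one edge, that is two darts, and removing leaves one by one exhausts
    [S]. *)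
Lemma leafy_inner_darts e S : symmetric e -> irreflexive e -> leafy e ->
  inner_darts e S <= 2 * #|S|.
Proof.
move=> sym_e irr_e leafy_e; move: {2}#|S| (leqnn #|S|) => n.
elim: n S => [|n IHn] S; first by rewrite leqn0 cards_eq0 => /eqP->; rewrite /inner_darts big_set0.
move=> leS; have [->|/leafy_e[x xS leaf]] := eqVneq S set0.
  by rewrite /inner_darts big_set0.
have eqS := setD1K xS; have xS' : x \notin S :\ x by rewrite !inE eqxx.
have cS : #|S| = #|S :\ x|.+1 by rewrite (cardsD1 x) xS.
rewrite -{1}eqS inner_dartsU1 //.
have le1 : #|[set y in S :\ x | e x y]| <= 1.
  apply: leq_trans leaf; apply: subset_leq_card; apply/subsetP => y.
  by rewrite !inE => /andP[/andP[_ ->] ->].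
have := IHn (S :\ x); lia.
Qed.

(** A vertex adjacent to the current set brings at least one new edge when it is added. A largest
    [D] satisfying the bound is all of [S]: a walk from [Q] to a missed vertex would leave [D] at a
    vertex that could be added. *)
Lemma spanning_inner_darts e S Q : symmetric e -> irreflexive e -> Q \subset S ->
  (forall x y, x \in S -> e x y -> y \in S) ->
  (forall x, x \in S -> exists2 r, r \in Q & connect e r x) ->
  2 * #|S| <= inner_darts e S + 2 * #|Q|.
Proof.
move=> sym_e irr_e sQS clS conS.
pose good := [pred D : {set V} | [&& Q \subset D, D \subset S &
   2 * #|D| <= inner_darts e D + 2 * #|Q|]].
have goodQ : good Q by rewrite /= subxx sQS leq_addl.
case: (arg_maxnP (fun D : {set V} => #|D|) goodQ) => D /= /and3P[QD DS goodD] maxD.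
have [SD|/subsetPn[x xS xD]] := boolP (S \subset D).
  by have /eqP -> : S == D by rewrite eqEsubset SD DS.
have [r rQ /connectP[s ps xE]] := conS x xS.
have {rQ} rD : r \in D by apply: (subsetP QD).
have [a [b [aD bD eab]]] : exists a b, [/\ a \in D, b \notin D & e a b].
  elim: s r rD ps xE => [|b s IHs] r rD /=; first by move=> _ xE; rewrite xE rD in xD.
  case/andP=> erb ps xE; have [bD|bD] := boolP (b \in D); first exact: IHs ps xE.
  by exists r, b.
have bS : b \in S by apply: clS eab; apply: (subsetP DS).
suff /maxD : good (b |: D) by rewrite cardsU1 bD /= ltnn.
rewrite /= subUset sub1set bS DS (subset_trans QD) ?subsetUr //= inner_dartsU1 // cardsU1 bD.
have : 0 < #|[set y in D | e b y]|.
  by apply/card_gt0P; exists a; rewrite inE aD sym_e.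
lia.
Qed.

(* Contracting the components of size at least [t] of [e1] turns the remaining
   edges of the forest [e] between them into a forest with at most #|S| / t vertices. *)
Lemma big_components_darts e e1 t S :
  symmetric e -> irreflexive e -> leafy e -> symmetric e1 -> subrel e1 e ->
  S = [set x | t <= #|connect e1 x|] ->
  t * inner_darts [rel x y | e x y && ~~ e1 x y] S <= 2 * #|S|.
Proof.
move=> sym_e irr_e leafy_e sym_e1 sub1 SE.
have irr_e1 : irreflexive e1 by move=> x; apply/negP => /sub1; rewrite irr_e.
have csym : connect_sym e1 by apply: sym_connect_sym.
pose rt := fingraph.root e1; pose Q := [set rt x | x in S].
have eqcard x y : connect e1 x y -> #|connect e1 x| = #|connect e1 y|.
  by move=> cxy; apply: eq_card => z; rewrite !inE; apply: same_connect.
have rtS x : (rt x \in S) = (x \in S).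
  by rewrite SE !inE (eqcard x (rt x)) // connect_root.
have sQS : Q \subset S by apply/subsetP => _ /imsetP[x xS ->]; rewrite rtS.
have split_e : inner_darts e S =
    inner_darts e1 S + inner_darts [rel x y | e x y && ~~ e1 x y] S.
  rewrite -big_split; apply: eq_bigr => x _ /=; rewrite -(cardsID [set y | e1 x y]).
  congr (_ + _); apply: eq_card => y; rewrite !inE.
    by case e1xy: (e1 x y); rewrite ?andbF // (sub1 _ _ e1xy) !andbT.
  by rewrite andbC andbA.
have le1 := leafy_inner_darts S sym_e irr_e leafy_e.
have le2 : 2 * #|S| <= inner_darts e1 S + 2 * #|Q|.
  apply: spanning_inner_darts => //.
    move=> x y; rewrite SE !inE => xS /connect1 cxy; by rewrite -(eqcard _ _ cxy).
  move=> x xS; exists (rt x); first exact: imset_f.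
  by rewrite csym connect_root.
have le3 : t * #|Q| <= #|S|.
  rewrite mulnC -sum_nat_const -[leqRHS]sum1_card [leqRHS](partition_big rt (mem Q)) /=; last first.
    by move=> x xS; apply: imset_f.
  apply: leq_sum => _ /imsetP[x xS ->]; rewrite sum1dep_card.
  move: (xS); rewrite SE inE => /leq_trans; apply.
  apply: subset_leq_card; apply/subsetP => y; rewrite !inE => cxy.
  have -> : rt y = rt x by apply/eqP; rewrite eq_sym root_connect.
  rewrite eqxx andbT; move: xS; rewrite SE !inE; by rewrite (eqcard _ _ cxy).
(* The two edge counts leave at most 2 #|Q| darts outside [e1], and t #|Q| <= #|S| since every
   component has at least t vertices. *)
nia.
Qed.

End Forests.

(** * Survival probabilities of open walks *)

Section Arms.
Variables (R : realFieldType) (W : finType) (h : rel W).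

(* With [q v w] the probability that the edge vw is open, [arm q k u v] is the
   probability that an open walk of length k leaves v away from u in the
   universal cover of h; for 0/1-valued q it is the indicator of that event. *)
Fixpoint arm (q : W -> W -> R) (k : nat) (u v : W) : R :=
  if k is k'.+1 then 1 - \prod_(w | h v w && (w != u)) (1 - q v w * arm q k' v w)
  else 1.

Variable q : W -> W -> R.
Hypothesis prob01 : forall v w, 0 <= q v w <= 1.

Lemma arm01 k u v : 0 <= arm q k u v <= 1.
Proof.
elim: k u v => [|k IHk] u v /=; first by rewrite ler01 lexx.
suff /andP[? ?] : 0 <= \prod_(w | h v w && (w != u)) (1 - q v w * arm q k v w) <= 1.
  by apply/andP; split; lra.
apply/andP; split.
  by apply: prodr_ge0 => w _; have /andP[? ?] := IHk v w; have /andP[? ?] := prob01 v w; nra.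
apply: prodr_ile1 => w _; have /andP[? ?] := IHk v w; have /andP[? ?] := prob01 v w.
by apply/andP; split; nra.
Qed.

Lemma arm_antimono k u v : arm q k.+1 u v <= arm q k u v.
Proof.
elim: k u v => [|k IHk] u v; first by have /andP[] := arm01 1 u v.
rewrite [arm q k.+2]/= [leRHS]/= -/(arm q k.+1) lerD2l lerN2.
apply: ler_prod => w _.
have /andP[? ?] := arm01 k v w; have /andP[? ?] := prob01 v w.
by rewrite subr_ge0 mulr_ile1 // lerD2l lerN2 ler_wpM2l ?IHk.
Qed.

End Arms.

(** * Non-backtracking walks below the girth *)

Section NonBacktracking.
Variables (W L : finType) (h : rel W) (lab : W -> W -> L).
Hypothesis sym_h : symmetric h.
Hypothesis labC : forall x y, lab x y = lab y x.
Hypothesis lab_inj : forall x y x' y', h x y -> h x' y' -> lab x y = lab x' y' ->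
  (x, y) = (x', y') \/ (x, y) = (y', x').

Local Notation dart := (W * W)%type.
Implicit Types (d f : dart) (ds : seq dart).

Definition nb d f : bool := [&& f.1 == d.2, f.2 != d.1 & h f.1 f.2].

(** The form in which large girth is used: no non-backtracking walk of at most l darts ends at its
    starting vertex. *)
Definition no_short_closed (l : nat) := forall d ds,
  h d.1 d.2 -> path nb d ds -> (size ds < l)%N -> (last d ds).2 != d.1.

Definition rev_dart d : dart := (d.2, d.1).

Lemma nb_path_all d ds : path nb d ds -> all (fun f => h f.1 f.2) ds.
Proof. by elim: ds d => //= f ds IHds d /andP[/and3P[_ _ ->] /IHds]. Qed.

Lemma nb_path_rev d ds : h d.1 d.2 -> path nb d ds ->
  path nb (rev_dart (last d ds)) (map rev_dart (rev (belast d ds))).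
Proof.
move=> hd pds; rewrite path_map rev_path.
have hds := nb_path_all pds.
apply: (sub_in_path (P := [pred f : dart | h f.1 f.2])) pds; last by rewrite /= hd.
move=> f f' hf hf' /and3P[/eqP ff' nff' _].
by apply/and3P; split; rewrite /= ?ff' // 1?eq_sym // sym_h.
Qed.

Lemma last_rev_belast d ds : last (last d ds) (rev (belast d ds)) = d.
Proof. by case: ds => //= f ds; rewrite rev_cons last_rcons. Qed.

(** Repeating the first edge in the same direction closes the walk at its starting vertex; repeating
    it in the opposite direction closes the part in between, or is a backtrack if nothing lies in
    between. *)
Lemma lab_ends l d ds : no_short_closed l -> h d.1 d.2 -> path nb d ds ->
  (0 < size ds <= l)%N -> lab d.1 d.2 != lab (last d ds).1 (last d ds).2.
Proof.
move=> girth hd; case/lastP: ds => // ds f; rewrite last_rcons rcons_path size_rcons /=.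
case/andP=> pds /and3P[/eqP f1 f2 hf] lt_l; apply/eqP => labE.
case: d f hd pds f1 f2 hf labE => [x y] [x' y'] /= hd pds f1 f2 hf.
case/(lab_inj hd hf) => -[E1 E2].
  by have := girth (x, y) ds hd pds lt_l; rewrite /= -f1 E1 eqxx.
case: ds pds lt_l f1 f2 => [|f ds] /=; first by rewrite E1 eqxx.
case/andP=> /and3P[/eqP f1 _ hf'] pds lt_l lastE _.
by have := girth f ds hf' pds (ltnW lt_l); rewrite -lastE f1 E2 eqxx.
Qed.

(** Reversing the first walk and appending the second gives a single non-backtracking walk across
    uv, whose two end edges differ. *)
Lemma lab_ends_opposite l u v ds1 ds2 : no_short_closed l -> h u v ->
  path nb (u, v) ds1 -> path nb (v, u) ds2 -> (0 < size ds1 + size ds2 <= l)%N ->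
  lab (last (u, v) ds1).1 (last (u, v) ds1).2 !=
  lab (last (v, u) ds2).1 (last (v, u) ds2).2.
Proof.
move=> girth huv p1 p2 le_l; set d := last (u, v) ds1.
have p1' := @nb_path_rev (u, v) ds1 huv p1.
have hd : h (rev_dart d).1 (rev_dart d).2.
  rewrite /= sym_h /d; case/lastP: ds1 p1 {p1' d le_l} => // ds f /nb_path_all.
  by rewrite all_rcons last_rcons => /andP[].
have lastE : last (rev_dart d) (map rev_dart (rev (belast (u, v) ds1))) = (v, u).
  by rewrite last_map last_rev_belast.
have := @lab_ends l (rev_dart d) (map rev_dart (rev (belast (u, v) ds1)) ++ ds2) girth hd.
rewrite cat_path p1' lastE p2 size_cat size_map size_rev size_belast le_l last_cat lastE.
by rewrite (labC (rev_dart d).1); apply.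
Qed.

(** The labels whose colours an arm of length k leaving the dart (u, v) can depend on. *)
Fixpoint reach (k : nat) (u v : W) : {set L} :=
  if k is k'.+1 then \bigcup_(w | h v w && (w != u)) (lab v w |: reach k' v w) else set0.

Lemma reach_walk k u v l : l \in reach k u v ->
  exists ds, [/\ path nb (u, v) ds, (0 < size ds <= k)%N &
    l = lab (last (u, v) ds).1 (last (u, v) ds).2].
Proof.
elim: k u v => [|k IHk] u v /=; first by rewrite inE.
case/bigcupP => w /andP[hvw wu]; rewrite !inE => /orP[/eqP->|/IHk[ds [pds sz ->]]].
  by exists [:: (v, w)]; split=> //=; rewrite /nb eqxx wu hvw.
exists ((v, w) :: ds); split=> //=; last by case/andP: sz.
by rewrite /nb eqxx wu hvw.
Qed.

Lemma lab_reach_walk k u v l : l \in lab u v |: reach k u v ->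
  exists ds, [/\ path nb (u, v) ds, (size ds <= k)%N &
    l = lab (last (u, v) ds).1 (last (u, v) ds).2].
Proof.
rewrite inE => /orP[|/reach_walk[ds [pds /andP[_ sz] ->]]]; last by exists ds.
by rewrite inE => /eqP ->; exists [::].
Qed.

Section Girth.
Variables (l k : nat).
Hypothesis girth : no_short_closed l.
Hypothesis k_l : (2 * k + 2 <= l)%N.

Lemma lab_notin_reach u v : h u v -> lab u v \notin reach k u v.
Proof.
move=> huv; apply/negP => /reach_walk[ds [pds sz]]; apply/eqP.
rewrite eq_sym (labC u); apply: (lab_ends_opposite (ds2 := [::]) girth) => //=; lia.
Qed.

Lemma reach_disjoint u v : h u v -> [disjoint reach k u v & reach k v u].
Proof.
move=> huv; apply/pred0P => z /=; apply/negP => /andP[].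
move=> /reach_walk[ds1 [p1 s1 ->]] /reach_walk[ds2 [p2 s2]]; apply/eqP.
by apply: (lab_ends_opposite girth); lia.
Qed.

(** The walk from (w, v) into (v, w') does not backtrack, so the two branches lie on opposite sides
    of the edge vw. *)
Lemma reach_branch_disjoint v w w' : h v w -> h v w' -> w != w' ->
  [disjoint lab v w |: reach k v w & lab v w' |: reach k v w'].
Proof.
move=> hw hw' ww'; apply/pred0P => z /=; apply/negP => /andP[].
move=> /lab_reach_walk[ds1 [p1 s1 ->]] /lab_reach_walk[ds2 [p2 s2]]; apply/eqP.
rewrite -[last (v, w') ds2]/(last (w, v) ((v, w') :: ds2)).
by apply: (lab_ends_opposite girth) => //=; rewrite /nb /= ?eqxx 1?eq_sym ?ww' ?hw' //; lia.
Qed.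

End Girth.

Lemma nb_path_uniq l d ds : no_short_closed l -> path nb d ds -> (size ds <= l)%N ->
  uniq (d.2 :: map snd ds).
Proof.
move=> girth; elim: ds d => [|f ds IHds] d //=; case/andP=> /and3P[/eqP fd _ hf] pds lt_l.
have := IHds f pds (ltnW lt_l); rewrite /= => ->; rewrite andbT.
apply/negP => din; have {din} /mapP[f' f'in f'E] : d.2 \in map snd (f :: ds) by [].
have : exists2 ds', path nb f ds' & (size ds' < l)%N && (last f ds' == f').
  move: f'in; rewrite inE => /orP[/eqP->|f'in]; first by exists [::]; rewrite //= eqxx (leq_ltn_trans _ lt_l).
  case/splitPr: f'in pds lt_l => s1 s2; rewrite -cat_rcons cat_path size_cat size_rcons => /andP[p1 _] sz.
  by exists (rcons s1 f') => //; rewrite last_rcons size_rcons eqxx; lia.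
case=> ds' pds' /andP[sz /eqP lastE].
by have := girth f ds' hf pds' sz; rewrite lastE -f'E fd eqxx.
Qed.

End NonBacktracking.

(** * First-round arms and second-round bridges *)

Lemma card_bigcup_le (T I : finType) (P : pred I) (F : I -> {set T}) n :
  (forall i, P i -> (#|F i| <= n)%N) -> (#|\bigcup_(i | P i) F i| <= #|P| * n)%N.
Proof.
move=> leF; rewrite -sum_nat_const.
elim/big_rec2: _ => [|i m A Pi leA]; first by rewrite cards0.
by rewrite (leq_trans (leq_card_setU _ _)) // leq_add // leF.
Qed.

Section TwoRounds.
Variables (R : realFieldType) (W L C : finType) (h : rel W) (lab : W -> W -> L).
Hypothesis sym_h : symmetric h.
Hypothesis irr_h : irreflexive h.
Hypothesis labC : forall x y, lab x y = lab y x.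
Hypothesis lab_inj : forall x y x' y', h x y -> h x' y' -> lab x y = lab x' y' ->
  (x, y) = (x', y') \/ (x, y) = (y', x').

Variables (a : C -> R) (c1 c2 : C).
Hypothesis a_ge0 : forall c, 0 <= a c.
Hypothesis a_sum1 : \sum_c a c = 1.
Hypothesis c1Nc2 : c1 != c2.

Local Notation Omega := {ffun L -> C}.
Implicit Types om : Omega.

Definition has_colour c om v w : R := (om (lab v w) == c)%:R.

Lemma has_colour01 c om v w : 0 <= has_colour c om v w <= 1.
Proof. by rewrite /has_colour; case: eqP; rewrite ?lexx ?ler01. Qed.

Lemma law_le1 c : 0 <= a c <= 1.
Proof. by rewrite a_ge0 -a_sum1 (bigD1 c) //= lerDl sumr_ge0. Qed.

Lemma expect_has_colour c v w : expect a (fun om => has_colour c om v w) = a c.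
Proof.
rewrite /has_colour (expect_coord a_sum1 (lab v w) (fun c' => (c' == c)%:R)).
rewrite (bigD1 c) //= eqxx mulr1 big1 ?addr0 // => c' /negbTE ->.
by rewrite mulr0.
Qed.

Lemma arm_depends (k : nat) u v :
  depends_on (reach h lab k u v) (fun om => arm h (has_colour c1 om) k u v).
Proof.
elim: k u v => [|k IHk] u v om om' eqom //=.
congr (1 - _); apply: eq_bigr => w vw; rewrite /has_colour.
rewrite (IHk v w om om') ?eqom //.
  by apply/bigcupP; exists w; rewrite // !inE eqxx.
by move=> l lin; apply: eqom; apply/bigcupP; exists w; rewrite // inE lin orbT.
Qed.

Variables (l k : nat).
Hypothesis girth : no_short_closed h l.
Hypothesis k_l : (2 * k + 2 <= l)%N.

Local Notation s := (arm h (fun _ _ => a c1)).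

(** Below half the girth the branches at v read disjoint sets of labels, and no arm reads the edge
    it starts from. Expectations therefore factorise and obey the recursion of the universal
    cover. *)
Lemma expect_arm j u v : (j <= k)%N ->
  expect a (fun om => arm h (has_colour c1 om) j u v) = s j u v.
Proof.
elim: j u v => [|j IHj] u v jk /=; first exact: expect_cst.
rewrite expectB expect_cst //; congr (1 - _).
under eq_expect do rewrite -big_filter.
rewrite -[RHS]big_filter.
have jl : (2 * j + 2 <= l)%N by lia.
rewrite (@expect_prod _ _ _ _ a_sum1 _ _ _ (fun w => lab v w |: reach h lab j v w)) //.
- rewrite big_seq [RHS]big_seq; apply: eq_bigr => w.
  rewrite mem_filter => /andP[/andP[hvw _] _].
  rewrite expectB expect_cst // (@expect_indep _ _ _ _ a_sum1 [set lab v w] (reach h lab j v w)) //.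
  + by rewrite expect_has_colour IHj // ltnW.
  + by move=> om om' eqom; rewrite /has_colour eqom // inE.
  + exact: arm_depends.
  + by rewrite disjoints1 (lab_notin_reach sym_h labC lab_inj girth jl).
- by rewrite filter_uniq // index_enum_uniq.
- move=> w _ om om' eqom; rewrite {1}/has_colour eqom ?inE ?eqxx //.
  rewrite (arm_depends (k := j) (om' := om')) // => z zin.
  by rewrite eqom // inE zin orbT.
- move=> w w'; rewrite !mem_filter => /andP[/andP[hw _] _] /andP[/andP[hw' _] _].
  by move=> ww'; apply: (reach_branch_disjoint sym_h labC lab_inj girth jl).
Qed.

(** The indicator that the edge of [d] is a second-round edge with a first-round arm of length k at
    both ends. *)
Definition bridge (d : W * W) om : R :=
  has_colour c2 om d.1 d.2 *
  (arm h (has_colour c1 om) k d.1 d.2 * arm h (has_colour c1 om) k d.2 d.1).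

Definition bridge_dep (d : W * W) : {set L} :=
  lab d.1 d.2 |: (reach h lab k d.1 d.2 :|: reach h lab k d.2 d.1).

Lemma bridge01 d om : 0 <= bridge d om <= 1.
Proof.
have prob01 := has_colour01 c1 om.
have /andP[? ?] := has_colour01 c2 om d.1 d.2.
have /andP[? ?] := arm01 h prob01 k d.1 d.2.
have /andP[? ?] := arm01 h prob01 k d.2 d.1.
by rewrite !mulr_ge0 // !mulr_ile1 // mulr_ge0.
Qed.

Lemma bridge_depends d : depends_on (bridge_dep d) (bridge d).
Proof.
move=> om om' eqom; rewrite /bridge {1}/has_colour eqom ?inE ?eqxx //.
rewrite (arm_depends (u := d.1) (om' := om')); last first.
  by move=> z zin; rewrite eqom // !inE zin orbT.
rewrite (arm_depends (u := d.2) (om' := om')) // => z zin.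
by rewrite eqom // !inE zin !orbT.
Qed.

Lemma expect_bridge d : h d.1 d.2 ->
  expect a (bridge d) = a c2 * (s k d.1 d.2 * s k d.2 d.1).
Proof.
move=> hd; have hd' : h d.2 d.1 by rewrite sym_h.
rewrite /bridge.
rewrite (@expect_indep _ _ _ _ a_sum1 [set lab d.1 d.2]
  (reach h lab k d.1 d.2 :|: reach h lab k d.2 d.1)) //; first last.
- rewrite disjoints1 inE negb_or.
  rewrite (lab_notin_reach sym_h labC lab_inj girth) //.
  by rewrite labC (lab_notin_reach sym_h labC lab_inj girth).
- move=> om om' eqom; congr (_ * _); apply: arm_depends => z zin.
    by rewrite eqom // inE zin.
  by rewrite eqom // inE zin orbT.
- by move=> om om' eqom; rewrite /has_colour eqom // inE.
rewrite expect_has_colour (expect_indep a_sum1 (@arm_depends k d.1 d.2) (@arm_depends k d.2 d.1)).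
  by rewrite !expect_arm.
exact: (reach_disjoint sym_h labC lab_inj girth).
Qed.

Definition darts : {set W * W} := [set d | h d.1 d.2].

Variable Delta : nat.
Hypothesis deg_le : forall x, (#|[set y | h x y]| <= Delta)%N.

(** The summand 2 lets one number bound both the labels read from a dart and the darts that read a
    given label, where an edge counts in both directions. *)
Fixpoint reach_bound (j : nat) : nat :=
  if j is j'.+1 then (Delta * (2 + reach_bound j'))%N else 0%N.

Lemma card_reach j u v : (#|reach h lab j u v| <= reach_bound j)%N.
Proof.
elim: j u v => [|j IHj] u v /=; first by rewrite cards0.
apply: leq_trans (card_bigcup_le (n := (2 + reach_bound j)%N) _) _ => [w _|].
  by rewrite (leq_trans (leq_card_setU _ _)) // cards1 leq_add.
rewrite leq_mul2r; apply/orP; right; apply: leq_trans (deg_le v).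
by apply: subset_leq_card; apply/subsetP => w; rewrite !inE => /andP[].
Qed.

Lemma card_darts_lab z : (#|[set d in darts | lab d.1 d.2 == z]| <= 2)%N.
Proof.
have [->|/set0Pn[d]] := eqVneq [set d in darts | lab d.1 d.2 == z] set0.
  by rewrite cards0.
rewrite !inE => /andP[hd /eqP <-]; apply: (@leq_trans #|[set d; rev_dart d]|); last first.
  by rewrite cards2; case: eqP.
apply: subset_leq_card; apply/subsetP => f; rewrite !inE => /andP[hf /eqP fd].
by case: f d hf hd fd => [x y] [x' y'] /= hf hd /(lab_inj hf hd)[]->; rewrite eqxx ?orbT.
Qed.

(** A dart (u, v) reaches z through some dart (v, w) that carries z or reaches it one level lower,
    and each such (v, w) has at most [Delta] predecessors u. *)
Lemma card_darts_reach j z :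
  (#|[set d in darts | z \in reach h lab j d.1 d.2]| <= reach_bound j)%N.
Proof.
elim: j z => [|j IHj] z /=.
  by rewrite leqn0 cards_eq0; apply/eqP/setP => d; rewrite !inE andbF.
pose F := [set d in darts | lab d.1 d.2 == z] :|: [set d in darts | z \in reach h lab j d.1 d.2].
have cF : (#|F| <= 2 + reach_bound j)%N.
  by rewrite (leq_trans (leq_card_setU _ _)) // leq_add // card_darts_lab.
apply: (@leq_trans #|\bigcup_(f in F) [set (u, f.1) | u in [set u | h f.1 u]]|).
  apply: subset_leq_card; apply/subsetP => -[u v]; rewrite !inE /=.
  case/andP=> huv /bigcupP[w /andP[hvw _] zin]; apply/bigcupP; exists (v, w).
    by rewrite !inE hvw /=; move: zin; rewrite !inE eq_sym.
  by apply/imsetP; exists u; rewrite // inE /= sym_h.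
apply: leq_trans (card_bigcup_le (n := Delta) _) _ => [f _|].
  by rewrite (leq_trans (leq_imset_card _ _)) // deg_le.
by rewrite mulnC leq_mul2l cF orbT.
Qed.

(** The first factor bounds the labels read by one bridge, the second the darts whose bridge reads a
    given label. *)
Definition overlap_bound := ((1 + 2 * reach_bound k) * (2 + 2 * reach_bound k))%N.

Lemma card_bridge_overlap d :
  (#|[set f in darts | ~~ [disjoint bridge_dep d & bridge_dep f]]| <= overlap_bound)%N.
Proof.
apply: (@leq_trans #|\bigcup_(z in bridge_dep d) [set f in darts | z \in bridge_dep f]|).
  apply: subset_leq_card; apply/subsetP => f; rewrite !inE => /andP[hf /pred0Pn[z /andP[/= zd zf]]].
  by apply/bigcupP; exists z => //; apply/setIdP; rewrite inE.
apply: leq_trans (card_bigcup_le (n := (2 + 2 * reach_bound k)%N) _) _ => [z _|].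
  pose A := [set f in darts | z \in reach h lab k f.1 f.2].
  apply: (@leq_trans #|[set f in darts | lab f.1 f.2 == z] :|: (A :|: [set rev_dart f | f in A])|).
    apply: subset_leq_card; apply/subsetP => f; rewrite !inE => /andP[hf].
    rewrite hf /= eq_sym => /orP[->|/orP[->|zf]] //; first by rewrite orbT.
    apply/orP; right; apply/orP; right; apply/imsetP.
    by exists (rev_dart f); rewrite ?inE /= ?zf 1?sym_h ?hf //; case: f hf zf.
  have := card_darts_reach k z; have := card_darts_lab z; have := leq_imset_card (@rev_dart W) A.
  rewrite -/A => le1 le2 le3.
  rewrite (leq_trans (leq_card_setU _ _)) // leq_add // mul2n -addnn.
  by rewrite (leq_trans (leq_card_setU _ _)) // leq_add // (leq_trans le1).
rewrite leq_mul2r; apply/orP; right.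
rewrite (leq_trans (leq_card_setU _ _)) // cards1 leq_add // mul2n -addnn.
by rewrite (leq_trans (leq_card_setU _ _)) // leq_add // card_reach.
Qed.

Definition bridges om : R := \sum_(d in darts) bridge d om.

Lemma expect_bridges :
  expect a bridges = a c2 * \sum_(d in darts) s k d.1 d.2 * s k d.2 d.1.
Proof.
rewrite expect_sum mulr_sumr; apply: eq_bigr => d; rewrite inE => hd.
by rewrite expect_bridge.
Qed.

Lemma variance_bridges :
  expect a (fun om => (bridges om - expect a bridges) ^+ 2) <=
  (#|darts| * overlap_bound)%:R.
Proof.
apply: le_trans (variance_sum_le a_ge0 a_sum1 (P := darts) (Y := bridge) (D := bridge_dep) _ _ _) _.
- by [].
- by move=> d _; apply: bridge_depends.
- by move=> d _ om; apply: bridge01.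
rewrite ler_nat -sum_nat_const; apply: leq_sum => d _; exact: card_bridge_overlap.
Qed.

Definition colour1_graph om : rel W := fun x y => h x y && (om (lab x y) == c1).
Definition open_graph om : rel W :=
  fun x y => h x y && ((om (lab x y) == c1) || (om (lab x y) == c2)).

Lemma arm_walk om j u v : arm h (has_colour c1 om) j u v != 0 ->
  exists ds, [/\ path (nb h) (u, v) ds, size ds = j &
    all (fun d => colour1_graph om d.1 d.2) ds].
Proof.
elim: j u v => [|j IHj] u v /= => [_|]; first by exists [::].
have [w /andP[/andP[hvw wu] nz] _|none] :=
  pickP (fun w => (h v w && (w != u)) && (has_colour c1 om v w * arm h (has_colour c1 om) j v w != 0)).
  move: nz; rewrite mulf_eq0 negb_or => /andP[cw /IHj[ds [pds sds ads]]].
  exists ((v, w) :: ds); split=> //=; first by rewrite /nb /= eqxx wu hvw.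
    by rewrite sds.
  rewrite ads andbT /colour1_graph hvw; move: cw; rewrite /has_colour.
  by case: (om (lab v w) == c1); rewrite ?eqxx.
rewrite big1 ?subrr ?eqxx // => w vw.
by have := none w; rewrite /= vw /= => /negbFE/eqP ->; rewrite subr0.
Qed.

(** An arm is an open walk of length k, whose vertices are distinct because of the girth. *)
Lemma arm_big_component om u v : arm h (has_colour c1 om) k u v != 0 ->
  (k <= #|connect (colour1_graph om) v|)%N.
Proof.
case/arm_walk => ds [pds sds ads].
have uds : uniq (v :: map snd ds).
  apply: (nb_path_uniq girth pds); lia.
apply: (@leq_trans (size (v :: map snd ds))); first by rewrite /= size_map sds.
rewrite -(card_uniqP uds); apply: subset_leq_card; apply/subsetP => x.
suff pv : path (colour1_graph om) v (map snd ds) by move=> xin; apply: (path_connect pv).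
elim: ds u v {uds} pds ads {sds} => //= -[x' y] ds IHds u v.
by case/andP=> /and3P[/= /eqP -> _ _] pds /= /andP[-> ads]; apply: IHds pds ads.
Qed.

Lemma bridges_le om : (1 < k)%N -> leafy (open_graph om) ->
  k%:R * bridges om <= (2 * #|[set x | (0 < #|[set y | h x y]|)%N]|)%:R.
Proof.
move=> k1 leafy_om; set e := open_graph om; set e1 := colour1_graph om.
have sym_e : symmetric e by move=> x y; rewrite /e /open_graph sym_h labC.
have sym_e1 : symmetric e1 by move=> x y; rewrite /e1 /colour1_graph sym_h labC.
have irr_e : irreflexive e by move=> x; rewrite /e /open_graph irr_h.
have sub1 : subrel e1 e by move=> x y /andP[hxy c]; rewrite /e /open_graph hxy c.
pose S := [set x | (k <= #|connect e1 x|)%N].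
have := big_components_darts sym_e irr_e leafy_om sym_e1 sub1 (erefl S).
set e2 := [rel x y | _] => bound.
(* As k > 1, a component with at least k vertices contains an edge at each of its vertices, so none
   of them is isolated in [h]. *)
have SH : (#|S| <= #|[set x | (0 < #|[set y | h x y]|)%N]|)%N.
  apply: subset_leq_card; apply/subsetP => x; rewrite !inE => kx.
  have /card_gt1P[y [z []]] := leq_trans k1 kx.
  rewrite !inE => cy cz yz.
  have [w cw wx] : exists2 w, connect e1 x w & w != x.
    by have [yx|] := eqVneq y x; [exists z; rewrite // -yx eq_sym|exists y].
  case/connectP: cw => -[|z' p] /=; first by move=> _ wE; rewrite wE eqxx in wx.
  by case/andP=> /andP[hxz _] _ _; apply/card_gt0P; exists z'; rewrite inE.
have XS : bridges om <= (inner_darts e2 S)%:R.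
  rewrite /inner_darts; under eq_bigr do rewrite -sum1dep_card.
  rewrite pair_big_dep natr_sum /bridges big_mkcond [leRHS]big_mkcond /=.
  apply: ler_sum => -[x y] _ /=; rewrite inE /=.
  have /andP[ge0 le1] := bridge01 (x, y) om.
  case: ifP => hxy; last by case: ifP => // _; rewrite ler01.
  case: ifPn => // noS; rewrite le_eqVlt; apply/orP; left.
  apply: contraNT noS; rewrite /bridge /= !mulf_eq0 !negb_or => /and3P[c a1 a2].
  rewrite !inE (arm_big_component a1) (arm_big_component a2) /=.
  rewrite /e /open_graph /e1 /colour1_graph hxy /=.
  move: c; rewrite /has_colour; case: (om (lab x y) =P c2) => [-> _|_]; last by rewrite eqxx.
  by rewrite orbT eq_sym.
apply: le_trans (ler_wpM2l _ XS) _; first by rewrite ler0n.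
by rewrite -natrM ler_nat (leq_trans bound) // leq_mul2l SH orbT.
Qed.

End TwoRounds.

(** * Inequalities for logarithms and for unions of independent events *)

Section RealInequalities.
Variable R : realType.
Implicit Types a x y z : R.

Lemma ln_le_subr1 x : 0 < x -> ln x <= x - 1.
Proof.
by move=> x0; have := @le_ln1Dx R (x - 1); rewrite (addrC 1) subrK; apply; lra.
Qed.

Lemma ln_ge_subrV x : 0 < x -> 1 - x^-1 <= ln x.
Proof.
move=> x0; have := ln_le_subr1 (x := x^-1); rewrite invr_gt0 lnV ?posrE // => /(_ x0).
lra.
Qed.

(* The tangent line at z = 1 of the function z |-> (1 + a z) ln z, which is convex
   for a z >= 1. *)
Lemma ln_tangent a z : 1 <= a -> 1 <= a * z -> (1 + a) * (z - 1) <= (1 + a * z) * ln z.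
Proof.
move=> a1 az1; have z0 : 0 < z by nra.
pose f x : R := (1 + a * x) * ln x - (1 + a) * (x - 1).
pose df x : R := a * ln x + x^-1 - 1.
have der x : 0 < x -> is_derive x (1 : R) f (df x).
  move=> x0; have xn : x != 0 by rewrite gt_eqF.
  have := is_derive1_ln x0 => dln.
  apply: is_derive_eq.
  rewrite /df /GRing.scale /=; field.
  by [].
have mvt x y : 0 < x -> x < y -> exists2 c, x < c < y & f y - f x = df c * (y - x).
  move=> x0 xy.
  have [||c] := @MVT R f df x y xy.
  - by move=> c; rewrite in_itv /= => /andP[xc _]; apply: der; apply: lt_trans xc.
  - apply: derivable_within_continuous => c; rewrite in_itv /= => /andP[xc _].
    by have [] := der c (lt_le_trans x0 xc).
  - by rewrite in_itv /=; exists c.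
have f1 : f 1 = 0 by rewrite /f ln1 subrr !mulr0 subr0.
suff : 0 <= f z by rewrite /f subr_ge0.
have [z1|z1|<-] := ltgtP 1 z; last by rewrite f1.
  have [c /andP[c1 cz]] := mvt _ _ ltr01 z1; rewrite f1 subr0 => ->.
  have c0 : 0 < c by lra.
  have := ln_ge_subrV c0; have := ln_ge0 (ltW c1) => l0 l1.
  by rewrite mulr_ge0 ?subr_ge0 ?(ltW z1) // /df; nra.
have [c /andP[zc c1]] := mvt _ _ z0 z1; rewrite f1 sub0r => fz.
have c0 : 0 < c by lra.
have := ln_le_subr1 c0 => lc.
have ic : c^-1 * c = 1 by rewrite mulVf // gt_eqF.
(* Here df c <= (1 - c) (1/c - a), and a c >= a z >= 1. *)
have : df c <= 0.
  rewrite /df.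
  have : a * ln c <= a * (c - 1) by rewrite ler_wpM2l //; lra.
  have ica : c^-1 <= a by rewrite invf_ple ?posrE; [|lra|lra]; rewrite -[a^-1]mulr1 mulrC ler_pdivrMr; nra.
  nra.
nra.
Qed.

(** Jensen's inequality for ln, obtained by summing ln t <= t - 1 at t = b_i N / B. *)
Lemma ln_sum_ge (I : finType) (P : pred I) (b : I -> R) :
  (forall i, P i -> 0 < b i) -> (0 < #|P|)%N ->
  #|P|%:R * ln #|P|%:R + \sum_(i | P i) ln (b i) <= #|P|%:R * ln (\sum_(i | P i) b i).
Proof.
move=> b0 P0; set N : R := #|P|%:R; set B := \sum_(i | P i) b i.
have N0 : 0 < N by rewrite ltr0n.
have B0 : 0 < B.
  have /card_gt0P[i Pi] := P0; rewrite /B (bigD1 i) //= ltr_pwDl ?b0 // sumr_ge0 // => j /andP[Pj _].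
  exact: ltW (b0 _ Pj).
have : \sum_(i | P i) (ln (b i) + ln N - ln B) <= \sum_(i | P i) (b i * (N / B) - 1).
  apply: ler_sum => i Pi; have bi := b0 _ Pi.
  have := ln_le_subr1 (x := b i * (N / B)); rewrite mulr_gt0 ?divr_gt0 // => /(_ isT).
  by rewrite lnM ?posrE ?divr_gt0 // ln_div ?posrE //; lra.
rewrite !(sumrB, big_split) /= -mulr_suml -/B !sumr_const.
have -> : B * (N / B) = N by field; rewrite gt_eqF.
rewrite -[#|(fun i => P i)|]/#|P| -mulr_natl -[_ *+ #|P|]mulr_natl -[1 *+ _]mulr_natl -/N; lra.
Qed.

(** For independent events this bounds the mean number Y of occurrences by S (1 + Y), where S is the
    probability that some event occurs. *)
Lemma prod_compl_le (I : finType) (P : pred I) (b : I -> R) :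
  (forall i, P i -> 0 <= b i <= 1) ->
  \prod_(i | P i) (1 - b i) * (1 + \sum_(i | P i) b i) <= 1.
Proof.
move=> b01; set A := \prod_(i | P i) _; set B := \sum_(i | P i) b i.
suff [] : [/\ 0 <= A, 0 <= B & A * (1 + B) <= 1] by [].
rewrite /A /B; elim/big_rec2: _ => [|i x y /b01/andP[b0 b1] [x0 y0 xy]]; first by split; lra.
have := mulr_ge0 (mulr_ge0 b0 b0) x0; have := mulr_ge0 (mulr_ge0 b0 y0) x0.
by split; [nra|lra|lra].
Qed.

Lemma prod_sum_ge1 (I : finType) (P : pred I) (b : I -> R) :
  (forall i, P i -> 0 <= b i <= 1) -> 1 <= \prod_(i | P i) (1 - b i) + \sum_(i | P i) b i.
Proof.
move=> b01.
suff [] : [/\ 0 <= \sum_(i | P i) b i &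
  1 <= \prod_(i | P i) (1 - b i) + \sum_(i | P i) b i] by [].
elim/big_rec2: _ => [|i x y /b01/andP[b0 b1] [le0 le1]]; first by split; lra.
by split; nra.
Qed.

(** The second Bonferroni inequality: the right-hand side is twice the sum of b_i b_j over unordered
    pairs. *)
Lemma sum_sub_union_le (I : finType) (P : pred I) (b : I -> R) :
  (forall i, P i -> 0 <= b i <= 1) ->
  2 * (\sum_(i | P i) b i - (1 - \prod_(i | P i) (1 - b i))) <=
  (\sum_(i | P i) b i) ^+ 2 - \sum_(i | P i) b i ^+ 2.
Proof.
move=> b01.
suff [] : [/\ 0 <= \sum_(i | P i) b i,
  1 - \sum_(i | P i) b i <= \prod_(i | P i) (1 - b i) &
  2 * (\sum_(i | P i) b i - (1 - \prod_(i | P i) (1 - b i))) <=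
  (\sum_(i | P i) b i) ^+ 2 - \sum_(i | P i) b i ^+ 2] by [].
elim/big_rec3: _ => [|i x y z /b01/andP[b0 b1] [le0 le1 le2]]; first by split; lra.
by split; nra.
Qed.

Lemma le_union (I : finType) (P : pred I) (b : I -> R) i :
  (forall i, P i -> 0 <= b i <= 1) -> P i -> b i <= 1 - \prod_(i | P i) (1 - b i).
Proof.
move=> b01 Pi; rewrite (bigD1 i) //=; set A := \prod_(_ | _) _.
have A1 : A <= 1.
  by apply: prodr_ile1 => j /andP[/b01/andP[? ?] _]; apply/andP; split; lra.
have /andP[? ?] := b01 _ Pi; nra.
Qed.

End RealInequalities.

(** * Unavoidable branching in graphs of large average degree *)

Section Growth.
Variables (R : realType) (W : finType) (h : rel W) (Delta : nat) (p m : R).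
Hypothesis sym_h : symmetric h.
Hypothesis p01 : 0 < p <= 1.
Hypothesis m_gt2 : 2 <= m.
Hypothesis supercritical : 1 < p * (m - 1).
Hypothesis deg_ge2 : forall x y, h x y -> (2 <= #|[set z | h x z]|)%N.
Hypothesis deg_le : forall x, (#|[set y | h x y]| <= Delta)%N.

Local Notation d x := #|[set y | h x y]|.
Local Notation s := (arm h (fun _ _ => p)).
Local Notation ndarts := (\sum_x d x)%N.

Hypothesis average_ge : m * #|[set x | (0 < d x)%N]|%:R <= ndarts%:R.

Definition arm_mean k u v := \sum_(w | h v w && (w != u)) p * s k v w.
Local Notation y := arm_mean.

Lemma prob01 (v w : W) : 0 <= p <= 1.
Proof. by case/andP: p01 => /ltW -> ->. Qed.

Lemma arm_term01 k u v w : h v w && (w != u) -> 0 <= p * s k v w <= 1.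
Proof.
move=> _; have /andP[? ?] := arm01 h prob01 k v w; have /andP[? ?] := prob01 v w.
by rewrite mulr_ge0 ?mulr_ile1.
Qed.

Lemma arm_gt0 k u v : h u v -> 0 < s k u v.
Proof.
elim: k u v => [|k IHk] u v huv //; have hvu : h v u by rewrite sym_h.
have /card_gt1P[w [w' []]] := deg_ge2 hvu; rewrite !inE => hw hw' ww'.
have [z hz zu] : exists2 z, h v z & z != u.
  by have [wu|] := eqVneq w u; [exists w'; rewrite // -wu eq_sym|exists w].
have Pz : h v z && (z != u) by rewrite hz zu.
have := le_union (@arm_term01 k u v) Pz; rewrite -/(s k.+1 u v); apply: lt_le_trans.
by rewrite mulr_gt0 ?IHk //; case/andP: p01.
Qed.

Lemma arm_mean_le k u v : y k u v <= Delta%:R * s k.+1 u v.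
Proof.
have := arm01 h prob01 k.+1 u v => /andP[s0 _].
apply: (@le_trans _ _ (\sum_(w | h v w && (w != u)) s k.+1 u v)).
  by apply: ler_sum => w vw; apply: (le_union (@arm_term01 k u v) vw).
rewrite sumr_const -[leLHS]mulr_natl ler_wpM2r // ler_nat.
apply: leq_trans (deg_le v); apply: subset_leq_card; apply/subsetP => w.
by rewrite !inE => /andP[].
Qed.

Lemma card_others v u : h v u -> #|[pred w | h v w && (w != u)]| = (d v).-1.
Proof.
move=> hvu; rewrite (cardsD1 u) inE hvu add1n /=.
by apply: eq_card => w; rewrite !inE andbC.
Qed.

(** Jensen's inequality is applied for each u to the d(v) - 1 continuations. In the sum over u every
    ln s(v, w) occurs d(v) - 1 times, which cancels the weight 1 / (d(v) - 1). *)
Lemma ln_arm_mean_vertex k v :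
  (d v)%:R * (ln ((d v)%:R - 1) + ln p) + \sum_(w | h v w) ln (s k v w) <=
  \sum_(u | h v u) ln (y k u v).
Proof.
have [hv|nov] := pickP (h v); last first.
  rewrite !big_pred0 // (_ : d v = 0%N) ?mul0r ?addr0 //.
  by apply/eqP; rewrite cards_eq0; apply/eqP/setP => w; rewrite !inE nov.
move=> hvw; have d2 := deg_ge2 hvw.
set D : R := (d v)%:R; have D2 : 2 <= D by rewrite ler_nat.
have Dp : (d v).-1%:R = D - 1 :> R by rewrite -subn1 natrB // ltnW.
have p0 : 0 < p by case/andP: p01.
have per u : h v u ->
    ln (D - 1) + ln p + (D - 1)^-1 * \sum_(w | h v w && (w != u)) ln (s k v w) <= ln (y k u v).
  move=> hvu; have cP := card_others hvu.
  have := @ln_sum_ge R W [pred w | h v w && (w != u)] (fun w => p * s k v w).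
  rewrite cP Dp -/(y k u v) /=.
  have sp w : h v w && (w != u) -> 0 < s k v w by case/andP=> hw _; apply: arm_gt0.
  move=> /(_ (fun w vw => mulr_gt0 p0 (sp w vw))); rewrite -ltnS prednK; last by apply: ltnW.
  move=> /(_ d2).
  rewrite (eq_bigr (fun w => ln p + ln (s k v w))); last first.
    by move=> w vw; rewrite lnM ?posrE ?sp.
  rewrite big_split /= sumr_const -[_ *+ _]mulr_natl.
  rewrite [#|_|](cP) Dp => le1; rewrite -subr_ge0.
  have D1 : 0 < D - 1 by lra.
  rewrite -(pmulr_rge0 _ D1) mulrBr !mulrDr mulrA divff ?gt_eqF // mul1r; lra.
apply: le_trans (ler_sum _ per).
rewrite big_split /= sumr_const -mulr_sumr.
rewrite (_ : #|_| = d v); last by apply: eq_card => w; rewrite !inE.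
rewrite -[_ *+ _]mulr_natl lerD2l.
rewrite (exchange_big_dep (h v)) /=; last by move=> u w _ /andP[].
rewrite mulr_sumr; apply: ler_sum => w hvw'.
rewrite (eq_bigl (fun u => h v u && (u != w))); last first.
  by move=> u; rewrite hvw' /= eq_sym.
rewrite sumr_const (card_others hvw') -[_ *+ _]mulr_natl Dp mulrA mulVf ?mul1r //.
by rewrite gt_eqF //; lra.
Qed.

Lemma sum_darts_sym (F : W -> W -> R) :
  \sum_v \sum_(w | h v w) F v w = \sum_v \sum_(u | h v u) F u v.
Proof.
rewrite (exchange_big_dep xpredT) //=; apply: eq_bigr => v _.
by apply: eq_bigl => u; rewrite sym_h.
Qed.

(** The convex function x ln (x - 1) lies above its tangent at x = m. The terms in d(x) - m have a
    positive coefficient and a nonnegative sum over the non-isolated vertices. *)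
Lemma ln_degree_sum : ndarts%:R * ln (m - 1) <= \sum_x (d x)%:R * ln ((d x)%:R - 1).
Proof.
set a := m - 1; have a1 : 1 <= a by rewrite lerBrDr.
have pt x : (d x)%:R * ln a + (1 + a^-1) * ((d x)%:R - m * (0 < d x)%N%:R) <=
    (d x)%:R * ln ((d x)%:R - 1).
  have [d0|] := posnP (d x); first by rewrite d0 !mul0r mulr0 subr0 mulr0 add0r.
  case/card_gt0P => z; rewrite inE => /deg_ge2; set D : R := (d x)%:R => d2.
  have D2 : 2 <= D by rewrite ler_nat.
  have D1 : 0 < D - 1 by lra.
  have a0 : 0 < a by lra.
  have az : a * ((D - 1) / a) = D - 1 by field; rewrite gt_eqF.
  have := @ln_tangent R a ((D - 1) / a) a1; rewrite az ln_div ?posrE // => /(_ _)H.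
  have {H} : (1 + a) * ((D - 1) / a - 1) <= (1 + (D - 1)) * (ln (D - 1) - ln a) by apply: H; lra.
  have -> : (1 + a) * ((D - 1) / a - 1) = (1 + a^-1) * (D - m).
    by rewrite /a; field; rewrite gt_eqF.
  by rewrite mulr1; lra.
have := @ler_sum R W (index_enum W) xpredT _ _ (fun x _ => pt x).
rewrite big_split /= -mulr_suml -natr_sum -mulr_sumr sumrB -natr_sum -mulr_sumr -natr_sum.
have -> : (\sum_x (0 < d x)%N = #|[set x | (0 < d x)%N]|)%N.
  by rewrite -sum1dep_card [RHS]big_mkcond; apply: eq_bigr => x _; case: (0 < _)%N.
apply: le_trans; rewrite lerDl mulr_ge0 ?subr_ge0 //.
by rewrite addr_ge0 // invr_ge0; lra.
Qed.

Local Notation eta := (ln (p * (m - 1))).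

(** Summing the vertex bound compares y_{k+1} with s_{k+1}, a dart and its reverse being summed
    alike; y_{k+1} <= y_k then permits y_k in its place. *)
Lemma ln_ratio_sum k :
  ndarts%:R * eta <= \sum_v \sum_(u | h v u) (ln (y k u v) - ln (s k.+1 u v)).
Proof.
have p0 : 0 < p by case/andP: p01.
have y_gt0 j u v : h v u -> 0 < y j u v.
  move=> hvu; have hu : h u v by rewrite sym_h.
  have := arm_mean_le j u v; have := arm_gt0 j.+1 hu.
  have /card_gt1P[w [w' []]] := deg_ge2 hvu; rewrite !inE => hw hw' ww' _ _.
  have [z hz zu] : exists2 z, h v z & z != u.
    by have [wu|] := eqVneq w u; [exists w'; rewrite // -wu eq_sym|exists w].
  rewrite /y (bigD1 z) /= ?hz ?zu // ltr_pwDl ?mulr_gt0 ?arm_gt0 //.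
  by apply: sumr_ge0 => x /andP[vx _]; have /andP[] := arm_term01 j vx.
have y_mono u v : y k.+1 u v <= y k u v.
  by apply: ler_sum => w _; rewrite ler_wpM2l ?(ltW p0) // arm_antimono //; apply: prob01.
have step := @ler_sum R W (index_enum W) xpredT _ _ (fun v _ => ln_arm_mean_vertex k.+1 v).
rewrite big_split /= (sum_darts_sym (fun v w => ln (s k.+1 v w))) in step.
rewrite (eq_bigr (fun x => (d x)%:R * ln ((d x)%:R - 1) + (d x)%:R * ln p)) in step; last first.
  by move=> x _; rewrite mulrDr.
rewrite big_split /= -mulr_suml -natr_sum in step.
have := ln_degree_sum; rewrite lnM ?posrE ?subr_gt0 ?(lt_le_trans _ m_gt2) ?ltr1n // => degs.
have : \sum_v \sum_(u | h v u) ln (y k.+1 u v) <= \sum_v \sum_(u | h v u) ln (y k u v).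
  by apply: ler_sum => v _; apply: ler_sum => u hvu; rewrite ler_ln ?posrE ?y_gt0.
under [X in _ -> _ <= X]eq_bigr do rewrite sumrB.
rewrite sumrB; lra.
Qed.

(** With r = Y / S - 1 one has ln (Y / S) <= r and 2 eta r - eta^2 <= r^2. Moreover r <= Y and 1 + r
    <= Delta give r^2 <= r Y = (1 + r) r S <= Delta (Y - S). *)
Lemma arm_mean_sub_ge k u v : h u v ->
  2 * eta * (ln (y k u v) - ln (s k.+1 u v)) - eta ^+ 2 <=
  Delta%:R * (y k u v - s k.+1 u v).
Proof.
move=> huv; set Y := y k u v; set S := s k.+1 u v.
have S0 : 0 < S by apply: arm_gt0.
have YS : S <= Y.
  have := prod_sum_ge1 (@arm_term01 k u v); rewrite -/(y k u v) -/Y.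
  by rewrite /S /=; lra.
have Y0 : 0 < Y by apply: lt_le_trans YS.
have YD : Y <= Delta%:R * S by apply: arm_mean_le.
have eta0 : 0 <= eta by rewrite ln_ge0 ?ltW.
have SY : Y <= S * (1 + Y).
  have := prod_compl_le (@arm_term01 k u v); rewrite -/(y k u v) -/Y.
  have -> : \prod_(w | h v w && (w != u)) (1 - p * s k v w) = 1 - S by rewrite /S /=; ring.
  lra.
pose r := Y / S - 1.
have YE : Y = (1 + r) * S by rewrite /r addrC subrK divfK ?gt_eqF.
have r0 : 0 <= r by rewrite /r subr_ge0 ler_pdivlMr ?mul1r.
have lnr : ln Y - ln S <= r.
  by rewrite -ln_div ?posrE // ln_le_subr1 // divr_gt0.
have rY : r <= Y by rewrite /r lerBlDr ler_pdivrMr // addrC mulrC.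
have rD : 1 + r <= Delta%:R by rewrite /r addrC subrK ler_pdivrMr.
have : r ^+ 2 <= Delta%:R * (Y - S).
  have -> : Y - S = r * S by rewrite {1}YE; ring.
  apply: (@le_trans _ _ ((1 + r) * (r * S))); last by rewrite ler_wpM2r // mulr_ge0 // ltW.
  have -> : (1 + r) * (r * S) = r * Y by rewrite {1}YE; ring.
  by rewrite expr2 ler_wpM2l.
have : eta * (ln Y - ln S) <= eta * r by rewrite ler_wpM2l.
have := sqr_ge0 (r - eta); rewrite !expr2; lra.
Qed.

(** Bonferroni bounds the excess by pairs of arms at v. Seen from w, the partners of the arm through
    w form part of y_k(w, v), which is at most Delta s_k(w, v); each pair thus becomes two opposite
    arms on vw. *)
Lemma arm_mean_sub_le k u v :
  y k u v - s k.+1 u v <= Delta%:R * \sum_(w | h v w) s k v w * s k w v.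
Proof.
set Y := y k u v; have /andP[/ltW p0 p1] := p01.
have s01 j x z : 0 <= s j x z <= 1 by apply: arm01; apply: prob01.
have le2 : Y - s k.+1 u v <= \sum_(w | h v w && (w != u)) p * s k v w * (Y - p * s k v w).
  have := sum_sub_union_le (@arm_term01 k u v); rewrite -/(y k u v) -/Y -/(s k.+1 u v).
  set Q := \sum_(_ | _) _ ^+ 2 => le2.
  have -> : \sum_(w | h v w && (w != u)) p * s k v w * (Y - p * s k v w) = Y ^+ 2 - Q.
    under eq_bigr do rewrite mulrBr -expr2.
    by rewrite sumrB -mulr_suml -/(y k u v) -/Y -expr2.
  have : 0 <= Y ^+ 2 - Q.
    apply: le_trans le2; rewrite mulr_ge0 // subr_ge0.
    have := prod_sum_ge1 (@arm_term01 k u v); rewrite -/(y k u v) -/Y /=; lra.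
  by move: le2; rewrite /=; lra.
apply: le_trans le2 _; rewrite mulr_sumr.
apply: (@le_trans _ _ (\sum_(w | h v w && (w != u)) Delta%:R * (s k v w * s k w v))).
  apply: ler_sum => w vw; have /andP[hvw wu] := vw.
  have /andP[sv0 sv1] := s01 k v w; have /andP[sw0 _] := s01 k w v.
  rewrite mulrCA; apply: ler_pM.
  - by rewrite mulr_ge0.
  - rewrite subr_ge0 /Y /y (bigD1 w) //= lerDl sumr_ge0 // => x /andP[vx _].
    by have /andP[] := arm_term01 k vx.
  - by rewrite ler_piMl.
  apply: (@le_trans _ _ (y k w v)).
    rewrite /Y /y (bigD1 w) //= [leLHS]addrC addKr.
    rewrite [leRHS]big_mkcond [leLHS]big_mkcond /=; apply: ler_sum => x _.
    case: ifP => [/andP[/andP[-> _] ->] //|_]; case: ifP => // vx.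
    by have /andP[] := arm_term01 k vx.
  apply: le_trans (arm_mean_le k w v) _; rewrite ler_wpM2l //.
  by apply: arm_antimono; apply: prob01.
rewrite big_mkcondr /=; apply: ler_sum => w _; case: ifP => // _.
have /andP[sv0 _] := s01 k v w; have /andP[sw0 _] := s01 k w v.
by rewrite !mulr_ge0.
Qed.

(** Summing both bounds on the excess over all darts leaves 2 eta^2 - eta^2 per dart on the left. Of
    the three factors [Delta], one counts the darts (u, v) with v fixed. *)
Lemma opposite_arms_ge k :
  ndarts%:R * eta ^+ 2 <= Delta%:R ^+ 3 * \sum_v \sum_(w | h v w) s k v w * s k w v.
Proof.
have eta0 : 0 <= eta by rewrite ln_ge0 ?ltW.
have nE (x : R) : \sum_v \sum_(u | h v u) x = ndarts%:R * x.
  rewrite natr_sum mulr_suml; apply: eq_bigr => v _; rewrite sumr_const -[LHS]mulr_natl.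
  by rewrite (_ : #|_| = d v) //; apply: eq_card => u; rewrite !inE.
set A := \sum_v \sum_(u | h v u) (y k u v - s k.+1 u v).
have leA : ndarts%:R * eta ^+ 2 <= Delta%:R * A.
  have : \sum_v \sum_(u | h v u)
      (2 * eta * (ln (y k u v) - ln (s k.+1 u v)) - eta ^+ 2) <= Delta%:R * A.
    rewrite /A mulr_sumr; apply: ler_sum => v _; rewrite mulr_sumr; apply: ler_sum => u hvu.
    by apply: arm_mean_sub_ge; rewrite sym_h.
  apply: le_trans; under [leRHS]eq_bigr do rewrite sumrB -mulr_sumr.
  rewrite sumrB -mulr_sumr nE; have := ln_ratio_sum k.
  set B := \sum_v _ => le1.
  have : eta * (ndarts%:R * eta) <= eta * B by rewrite ler_wpM2l.
  rewrite expr2; lra.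
apply: le_trans leA _; rewrite exprS -mulrA ler_wpM2l // expr2 -mulrA.
set F := fun v => \sum_(w | h v w) s k v w * s k w v.
rewrite -[X in _ * (_ * X)]/(\sum_v F v) !mulr_sumr.
apply: ler_sum => v _; set B := F v.
apply: (@le_trans _ _ (\sum_(u | h v u) Delta%:R * B)).
  by apply: ler_sum => u _; apply: arm_mean_sub_le.
rewrite sumr_const -[leLHS]mulr_natl ler_wpM2r ?mulr_ge0 //.
  by apply: sumr_ge0 => w _; rewrite mulr_ge0 //;
    have /andP[] := arm01 h prob01 k v w; have /andP[] := arm01 h prob01 k w v.
rewrite ler_nat (leq_trans _ (deg_le v)) //.
by apply: subset_leq_card; apply/subsetP => u; rewrite !inE.
Qed.

End Growth.

(** * Second-moment bound for the forest event *)

Section Core.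
Variables (R : realType) (W L C : finType) (h : rel W) (lab : W -> W -> L).
Variables (a : C -> R) (c1 c2 : C) (l k Delta : nat) (m delta : R).

Lemma sum_darts (F : W -> W -> R) :
  \sum_(d in darts h) F d.1 d.2 = \sum_v \sum_(w | h v w) F v w.
Proof.
by rewrite pair_big_dep /=; apply: eq_bigl => -[v w]; rewrite inE.
Qed.

Lemma card_darts : #|darts h| = (\sum_x #|[set y | h x y]|)%N.
Proof.
under eq_bigr do rewrite -sum1dep_card.
rewrite pair_big_dep /= sum1dep_card; apply: eq_card => -[v w].
by rewrite !inE.
Qed.

(** The expected number of bridges is at least c M for M darts. In a forest it is at most M / k <= c
    M / 2, and Chebyshev's inequality with variance at most M times the overlap bound makes this
    deviation unlikely. *)
Lemma leafy_prob_le :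
  symmetric h -> irreflexive h -> (forall x y, lab x y = lab y x) ->
  (forall x y x' y', h x y -> h x' y' -> lab x y = lab x' y' ->
     (x, y) = (x', y') \/ (x, y) = (y', x')) ->
  (forall c, 0 <= a c) -> \sum_c a c = 1 -> c1 != c2 ->
  no_short_closed h l -> (2 * k + 2 <= l)%N -> (1 < k)%N ->
  (forall x, (#|[set y | h x y]| <= Delta)%N) ->
  (forall x y, h x y -> (2 <= #|[set z | h x z]|)%N) ->
  2 <= m -> 0 < a c1 -> 1 < a c1 * (m - 1) ->
  m * #|[set x | (0 < #|[set y | h x y]|)%N]|%:R <= #|darts h|%:R ->
  0 < delta -> delta <= a c2 -> (0 < #|darts h|)%N ->
  let c := delta * ln (a c1 * (m - 1)) ^+ 2 / Delta%:R ^+ 3 in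
  2 <= k%:R * c ->
  expect a (fun om => `[< leafy (open_graph h lab c1 c2 om) >]%:R) <=
    4 * (overlap_bound k Delta)%:R / (c ^+ 2 * #|darts h|%:R).
Proof.
move=> sym_h irr_h labC lab_inj a0 a1 c12 girth kl k1 degD deg2 m2 p0 sup avg d0 dc2 M0 c kc.
set M : R := #|darts h|%:R.
have Mp : 0 < M by rewrite ltr0n.
have D0 : 0 < Delta%:R :> R.
  have /card_gt0P[[x y]] := M0; rewrite inE /= => /deg2 d2.
  by rewrite ltr0n (leq_trans _ (degD x)) // ltnW.
have p01 : 0 < a c1 <= 1 by rewrite p0; case/andP: (law_le1 a0 a1 c1).
have eta0 : 0 < ln (a c1 * (m - 1)) by rewrite ln_gt0.
have c0 : 0 < c by rewrite !(mulr_gt0, divr_gt0, exprn_gt0, invr_gt0).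
have EX : c * M <= expect a (bridges R h lab c1 c2 k).
  rewrite (expect_bridges sym_h labC lab_inj a1 c12 girth kl).
  rewrite (sum_darts (fun x y => arm h (fun _ _ => a c1) k x y * arm h (fun _ _ => a c1) k y x)).
  have avg' := avg; rewrite card_darts in avg'.
  have := opposite_arms_ge sym_h p01 m2 sup deg2 degD avg' k.
  rewrite -card_darts -/M; set S := \sum_v _ => le1.
  have S0 : 0 <= S.
    rewrite /S; apply: sumr_ge0 => v _; apply: sumr_ge0 => w _.
    have prob01 (x y : W) : 0 <= a c1 <= 1 by apply: law_le1.
    by rewrite mulr_ge0 //; [have /andP[] := arm01 h prob01 k v w|have /andP[] := arm01 h prob01 k w v].
  apply: (@le_trans _ _ (delta * S)); last by rewrite ler_wpM2r.
  rewrite /c mulrAC ler_pdivrMr ?exprn_gt0 // -!mulrA ler_wpM2l ?(ltW d0) //; lra.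
have t0 : 0 < c * M / 2 by rewrite divr_gt0 // mulr_gt0.
have var := variance_bridges sym_h lab_inj c1 c2 a0 a1 k degD.
have bad om : `[< leafy (open_graph h lab c1 c2 om) >] ->
    bridges R h lab c1 c2 k om <= expect a (bridges R h lab c1 c2 k) - c * M / 2.
  move/asboolP => leaf; have := bridges_le R sym_h irr_h labC c12 girth kl k1 leaf.
  rewrite natrM => le1.
  have n2 : 2 * #|[set x | (0 < #|[set y | h x y]|)%N]|%:R <= M.
    by apply: le_trans avg; rewrite ler_wpM2r.
  have k0 : 0 < k%:R :> R by rewrite ltr0n ltnW.
  have : bridges R h lab c1 c2 k om <= c * M / 2.
    rewrite -(ler_pM2l k0) (le_trans le1) // (le_trans n2) //.
    have : 2 * M <= k%:R * c * M by rewrite ler_wpM2r // ltW.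
    by lra.
  by lra.
have := chebyshev_lower a0 t0 bad var; rewrite natrM -/M => /le_trans; apply.
by rewrite le_eqVlt; apply/orP; left; apply/eqP; field; rewrite !gt_eqF.
Qed.

End Core.

(** * Dense subgraphs of minimum degree two *)

Section MinDegree.
Variables (R : realType) (W : finType) (h0 : rel W) (m : R).
Hypothesis sym_h : symmetric h0.
Hypothesis irr_h : irreflexive h0.
Hypothesis m_gt2 : 2 < m.

(* A vertex set maximising #darts - m #vertices has minimum degree at least m / 2. *)
Lemma dense_core (U0 : {set W}) : (forall x y, h0 x y -> x \in U0) ->
  exists h : rel W, [/\ symmetric h, subrel h h0,
    forall x y, h x y -> (2 <= #|[set z | h x z]|)%N,
    m * #|[set x | (0 < #|[set y | h x y]|)%N]|%:R <= #|darts h|%:R &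
    #|darts h0|%:R - m * #|U0|%:R <= #|darts h|%:R].
Proof.
move=> U0h; pose f (U : {set W}) : R := (inner_darts h0 U)%:R - m * #|U|%:R.
have [U _ maxU'] := @arg_maxP _ R {set W} set0 xpredT f isT.
have maxU U' : f U' <= f U by apply: maxU'.
pose h x y := [&& h0 x y, x \in U & y \in U].
have m0 : 0 < m by apply: lt_trans m_gt2; rewrite ltr0n.
have degE x : x \in U -> [set y | h x y] = [set y in U | h0 x y].
  by move=> xU; apply/setP => y; rewrite !inE /h xU /= andbC.
have dE : #|darts h| = inner_darts h0 U.
  rewrite card_darts /inner_darts [RHS]big_mkcond; apply: eq_bigr => x _.
  case: ifP => xU; first by rewrite degE.
  by apply/eqP; rewrite cards_eq0; apply/eqP/setP => y; rewrite !inE /h xU andbF.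
have fU0 : f U0 = #|darts h0|%:R - m * #|U0|%:R.
  congr (_%:R - _); rewrite card_darts /inner_darts big_mkcond; apply: eq_bigr => x _.
  case: ifPn => xU.
    apply: eq_card => y; rewrite !inE andbC; case hxy: (h0 x y) => //=.
    by apply: (U0h y x); rewrite sym_h.
  apply/eqP; rewrite eq_sym cards_eq0; apply/eqP/setP => y; rewrite !inE.
  by apply/negP => /U0h; apply/negP.
exists h; split.
- by move=> x y; rewrite /h sym_h (andbC (x \in U)).
- by move=> x y /andP[].
- move=> x y /and3P[_ xU _]; rewrite degE //.
  have xU' : x \notin U :\ x by rewrite !inE eqxx.
  (* Removing a vertex with at most one neighbour would lose at most 2 darts and gain m > 2. *)
  have := maxU (U :\ x); rewrite /f.
  have -> : inner_darts h0 U = (inner_darts h0 (U :\ x) + 2 * #|[set y in U :\ x | h0 x y]|)%N.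
    by rewrite -{1}(setD1K xU) inner_dartsU1.
  have <- : [set y in U :\ x | h0 x y] = [set z in U | h0 x z].
    by apply/setP => z; rewrite !inE; case: eqVneq => // ->; rewrite irr_h !andbF.
  rewrite (cardsD1 x U) xU natrD natrM natrD => le1.
  rewrite ltnNge; apply/negP => deg1.
  have : #|[set y0 in U :\ x | h0 x y0]|%:R <= 1 :> R by rewrite -[1]/(1%:R) ler_nat.
  move: m_gt2 le1; rewrite /= ; lra.
(* Comparison with the empty set, where the functional vanishes, gives the average degree. *)
- have := maxU set0; rewrite /f cards0 mulr0 subr0 /inner_darts big_set0 -/(inner_darts h0 U).
  rewrite dE subr_ge0; apply: le_trans; rewrite ler_wpM2l ?(ltW m0) // ler_nat.
  apply: subset_leq_card; apply/subsetP => x; rewrite inE => /card_gt0P[y].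
  by rewrite inE => /and3P[].
- rewrite -fU0 dE (le_trans (maxU U0)) // /f lerBlDr lerDl.
  by rewrite mulr_ge0 // ltW.
Qed.

End MinDegree.

(** * Packing short circuits or destroying them *)

Section Circuits.
Variables (V : finType).
Implicit Types (g : rel V) (c : seq V).

Definition short_circuit_free (l : nat) g := forall c,
  (3 <= size c <= l)%N -> uniq c -> ~~ cycle g c.

(** By induction all vertices of the walk are distinct. A return to the start cannot be at either of
    the next two vertices, by irreflexivity and non-backtracking, so it would close a short
    circuit. *)
Lemma short_circuit_free_nb l g : symmetric g -> irreflexive g ->
  short_circuit_free l g -> no_short_closed g l.
Proof.
move=> sym_g irr_g free d ds hd pds szd.
suff : uniq (d.1 :: d.2 :: map snd ds).
  rewrite cons_uniq => /andP[/negP d1 _]; apply/negP => /eqP d1E; apply: d1; rewrite -d1E.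
  by rewrite -last_map mem_last.
elim: ds d hd pds szd => [|f ds IHds] d hd.
  by move=> _ _; rewrite /= inE andbT; apply: contraTneq hd => ->; rewrite irr_g.
move=> /= /andP[/and3P[/eqP fd fd1 hf] pds] szd.
have := IHds f hf pds (ltnW szd); rewrite fd => utail.
apply/andP; split; last exact: utail.
apply/negP; rewrite inE => /orP[/eqP dd|]; first by rewrite dd irr_g in hd.
rewrite inE eq_sym (negbTE fd1) /= => d1in.
have pg : path g d.2 (f.2 :: map snd ds).
  rewrite /= -{1}fd hf /=; move: pds; clear; elim: ds f => //= e ds IHds f.
  by case/andP=> /and3P[/eqP <- _ ->] /IHds.
rewrite -(size_map snd) in szd.
case/splitPr: d1in utail pg szd => s1 s2 utail pg szd.
suff /negP : ~~ cycle g [:: d.1, d.2, f.2 & s1].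
  apply; rewrite /= hd rcons_path; move: pg; rewrite /= cat_path /=.
  by case/andP=> -> /and3P[-> ->].
apply: free; first by move: szd; rewrite /= size_cat /=; lia.
move: utail; rewrite -cat_cons -cat_cons -cat_rcons cat_uniq => /and3P[ut _ _].
by move: ut; rewrite rcons_uniq.
Qed.

Definition circuit_edges c : {set {set V}} := [set [set x; next c x] | x in c].

Lemma card_circuit_edges c : (#|circuit_edges c| <= size c)%N.
Proof. by rewrite (leq_trans (leq_imset_card _ _)) // card_size. Qed.

Lemma circuit_edges_circuit c (F : {set {set V}}) : (3 <= size c)%N -> uniq c ->
  circuit_edges c \subset F -> contains_circuit (spanning_subgraph F).
Proof.
move=> sz uc /subsetP cF; exists c; split=> //.
by apply: cycle_from_next => // x xc; apply: cF; apply: imset_f.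
Qed.

Lemma circuit_edges_sub g c : cycle g c -> circuit_edges c \subset edges g.
Proof.
move=> cyc; apply/subsetP => _ /imsetP[x xc ->].
by apply/imsetP; exists (x, next c x); rewrite // inE /= next_cycle.
Qed.

Lemma edgesE g x y : symmetric g -> ([set x; y] \in edges g) = g x y.
Proof.
move=> sym_g; apply/imsetP/idP => [[[x' y']]|gxy]; last by exists (x, y); rewrite ?inE.
rewrite inE /= => gxy eqs.
have := set21 x y; have := set22 x y; rewrite eqs !inE.
have := set21 x' y'; have := set22 x' y'; rewrite -eqs !inE.
by do 4![case/orP=> /eqP ?]; subst; rewrite // sym_g.
Qed.

Definition delete_edges (D : {set {set V}}) g : rel V :=
  fun x y => g x y && ([set x; y] \notin D).

Lemma delete_edges_sym D g : symmetric g -> symmetric (delete_edges D g).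
Proof. by move=> sym_g x y; rewrite /delete_edges sym_g setUC. Qed.

Lemma delete_edgesU D D' g :
  delete_edges D' (delete_edges D g) =2 delete_edges (D :|: D') g.
Proof. by move=> x y; rewrite /delete_edges inE negb_or andbA. Qed.

(** Greedy choice: remove the edges of a short circuit as long as one exists. Either K edge-disjoint
    ones are found, or fewer removals of at most l edges each destroy them all. *)
Lemma short_circuits_packing (l K : nat) g : symmetric g ->
  (exists r : seq {set {set V}}, [/\ uniq r, size r = K,
      {in r &, forall E E' : {set {set V}}, E != E' -> [disjoint E & E']} &
      {in r, forall E : {set {set V}}, [/\ (#|E| <= l)%N, E \subset edges g &
        forall F : {set {set V}}, E \subset F -> contains_circuit (spanning_subgraph F)]}]) \/
  (exists2 D : {set {set V}}, (#|D| <= K * l)%N &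
     short_circuit_free l (delete_edges D g)).
Proof.
elim: K g => [|K IHK] g sym_g; first by left; exists [::].
have [free|/existsNP[c /not_implyP[sz /not_implyP[uc /negP/negPn cyc]]]] := pselect (short_circuit_free l g).
  right; exists set0; first by rewrite cards0.
  move=> c sz uc; have := free c sz uc; congr (~~ _); case: c {sz uc} => //= x c.
  by apply: eq_path => y z; rewrite /delete_edges inE andbT.
set E := circuit_edges c; case/andP: (sz) => sz3 szl.
have El : (#|E| <= l)%N by rewrite (leq_trans (card_circuit_edges c)).
have Eg : E \subset edges g := circuit_edges_sub cyc.
have [] := IHK (delete_edges E g) (delete_edges_sym E sym_g); last first.
  case=> D Dl free; right; exists (E :|: D).
    by rewrite (leq_trans (leq_card_setU _ _)) // mulSn leq_add.
  move=> c' sz' uc'; have := free c' sz' uc'; congr (~~ _); case: c' {sz' uc'} => //= x c'.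
  by apply: eq_path => y z; rewrite delete_edgesU.
case=> r [ur szr dis rP]; left; exists (E :: r).
have disE E' : E' \in r -> [disjoint E & E'].
  case/rP=> _ /subsetP sub _; apply/pred0P => e /=; apply/negP => /andP[eE /sub].
  by case/imsetP=> -[x y]; rewrite inE => /andP[_ xyE] eE'; rewrite -eE' eE in xyE.
have E0 : E != set0.
  have [x xc] : exists x, x \in c by case: (c) sz3 => // x c' _; exists x; rewrite mem_head.
  by apply/set0Pn; exists [set x; next c x]; apply: imset_f.
split.
- rewrite /= ur andbT; apply/negP => /disE.
  by rewrite -setI_eq0 setIid (negbTE E0).
- by rewrite /= szr.
- move=> A B; rewrite !inE => /orP[/eqP->|Ar] /orP[/eqP->|Br].
  + by rewrite eqxx.
  + by move=> _; apply: disE.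
  + by move=> _; rewrite disjoint_sym; apply: disE.
  + exact: dis.
- move=> A; rewrite inE => /orP[/eqP->|/rP[Al Ag AF]].
    by split=> // F; apply: circuit_edges_circuit.
  split=> //; apply: (subset_trans Ag); apply/subsetP => _ /imsetP[z zP ->].
  by apply/imsetP; exists z => //; move: zP; rewrite !inE => /andP[].
Qed.

Lemma card_darts_delete D g : symmetric g ->
  (#|darts g| <= #|darts (delete_edges D g)| + 2 * #|D|)%N.
Proof.
move=> sym_g; rewrite -(cardsID [set d | [set d.1; d.2] \in D]) addnC leq_add //.
  by apply: subset_leq_card; apply/subsetP => d; rewrite !inE andbC.
have card2 e : (#|[set d : V * V | [set d.1; d.2] == e]| <= 2)%N.
  have [->|/set0Pn[[x y]]] := eqVneq [set d : V * V | [set d.1; d.2] == e] set0.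
    by rewrite cards0.
  rewrite inE /= => /eqP <-; apply: (@leq_trans #|[set (x, y); (y, x)]|).
    apply: subset_leq_card; apply/subsetP => -[x' y']; rewrite !inE /= => /eqP eqs.
    have := set21 x y; have := set22 x y; rewrite -eqs !inE.
    have := set21 x' y'; have := set22 x' y'; rewrite eqs !inE.
    by do 4![case/orP=> /eqP ?]; subst; rewrite !eqxx ?orbT.
  by rewrite cards2; case: eqP.
rewrite mulnC; apply: leq_trans (card_bigcup_le (P := mem D) (fun e _ => card2 e)).
apply: subset_leq_card; apply/subsetP => d; rewrite !inE => /andP[_ dD].
by apply/bigcupP; exists [set d.1; d.2]; rewrite // inE.
Qed.

End Circuits.

(** * Splitting vertices of high degree *)

Section Splitting.
Variables (V : finType) (g : rel V) (B : nat).
Hypothesis sym_g : symmetric g.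
Hypothesis irr_g : irreflexive g.
Hypothesis B_gt0 : (0 < B)%N.

Local Notation W := (V * 'I_#|V|.+1)%type.
Implicit Types v w : W.

Definition nbrs x := enum [set y | g x y].

(* The neighbours of x are listed and cut into blocks of B, one for each copy of x. *)
Definition block x y : 'I_#|V|.+1 := inord (index y (nbrs x) %/ B).

(** An edge xy joins the copy of x whose block holds y to the copy of y whose block holds x, so
    every edge lifts uniquely. *)
Definition split_graph : rel W :=
  fun v w => [&& g v.1 w.1, v.2 == block v.1 w.1 & w.2 == block w.1 v.1].

Definition split_edge v w : {set V} := [set v.1; w.1].

Lemma mem_nbrs x y : (y \in nbrs x) = g x y.
Proof. by rewrite mem_enum inE. Qed.

Lemma size_nbrs x : size (nbrs x) = #|[set y | g x y]|.
Proof. by rewrite -cardE. Qed.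

Lemma blockE x y : block x y = (index y (nbrs x) %/ B)%N :> nat.
Proof.
rewrite inordK // ltnS (leq_trans (leq_div _ _)) // (leq_trans (index_size _ _)) //.
by rewrite size_nbrs max_card.
Qed.

Lemma split_graph_sym : symmetric split_graph.
Proof. by move=> v w; rewrite /split_graph sym_g (andbC (v.2 == _)). Qed.

Lemma split_graph_irr : irreflexive split_graph.
Proof. by move=> v; rewrite /split_graph irr_g. Qed.

Lemma split_edgeC v w : split_edge v w = split_edge w v.
Proof. by rewrite /split_edge setUC. Qed.

Lemma split_edge_inj v w v' w' : split_graph v w -> split_graph v' w' ->
  split_edge v w = split_edge v' w' -> (v, w) = (v', w') \/ (v, w) = (w', v').
Proof.
case: v w v' w' => [x i] [y j] [x' i'] [y' j'].
case/and3P=> /= gxy /eqP -> /eqP -> /and3P[/= gxy' /eqP -> /eqP ->].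
rewrite /split_edge /= => eqs.
have := set21 x y; have := set22 x y; rewrite eqs !inE.
have := set21 x' y'; have := set22 x' y'; rewrite -eqs !inE.
by do 4![case/orP=> /eqP ?]; subst; rewrite ?irr_g // in gxy gxy' *; auto.
Qed.

Lemma split_graph_deg v : (#|[set w | split_graph v w]| <= B)%N.
Proof.
set A := [set w | _]; rewrite cardE -(size_map (fun w => index w.1 (nbrs v.1))).
rewrite -(size_iota (v.2 * B) B); apply: uniq_leq_size.
  rewrite map_inj_in_uniq ?enum_uniq // => w w'; rewrite !mem_enum !inE.
  case: w w' => [y j] [y' j'] /and3P[/= gy _ /eqP->] /and3P[/= gy' _ /eqP->] eqi.
  have -> : y = y' by rewrite -(nth_index y (s := nbrs v.1) (x := y)) ?mem_nbrs // eqi nth_index // mem_nbrs.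
  by [].
move=> z /mapP[w]; rewrite mem_enum inE => /and3P[_ /eqP v2 _] ->.
by rewrite mem_iota v2 blockE; lia.
Qed.

Lemma card_darts_split : #|darts split_graph| = #|darts g|.
Proof.
pose f (d : V * V) : W * W := ((d.1, block d.1 d.2), (d.2, block d.2 d.1)).
have finj : injective f by move=> [x y] [x' y'] [-> _ ->].
rewrite -(card_imset _ finj); apply: eq_card => -[[x i] [y j]]; rewrite inE /=.
apply/idP/imsetP => [/and3P[/= gxy /eqP-> /eqP->]|[[x' y']]].
  by exists (x, y); rewrite ?inE.
by rewrite inE /= => gxy [-> -> -> ->]; rewrite /split_graph /= gxy !eqxx.
Qed.

(** These copies include all non-isolated ones, and each x has at most deg(x) / B + 1 of them. *)
Definition split_vertices : {set W} := [set v : W | (v.2 * B <= #|[set y | g v.1 y]|)%N].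

Lemma split_vertices_darts v w : split_graph v w -> v \in split_vertices.
Proof.
case/and3P=> gvw /eqP v2 _; rewrite inE v2 blockE.
rewrite (leq_trans (leq_trunc_div _ _)) // -size_nbrs; exact: index_size.
Qed.

Lemma card_split_vertices : (B * #|split_vertices| <= B * #|V| + #|darts g|)%N.
Proof.
rewrite card_darts -sum1_card (partition_big fst xpredT) //= !big_distrr /=.
have -> : (B * #|V| = \sum_(x : V) B)%N by rewrite sum_nat_const mulnC.
rewrite -big_split /=.
apply: leq_sum => x _; rewrite sum1dep_card.
set d := #|[set y | g x y]|; pose f (i : 'I_(d %/ B).+1) : W := (x, inord i).
apply: (@leq_trans (B * #|f @: setT|)).
  rewrite leq_mul2l; apply/orP; right; apply: subset_leq_card; apply/subsetP => -[x' i].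
  rewrite !inE /= => /andP[iB /eqP xE]; subst x'.
  have lti : (i < (d %/ B).+1)%N by rewrite ltnS leq_divRL.
  apply/imsetP; exists (Ordinal lti) => //; congr (_, _); apply: val_inj.
  by rewrite /= inordK.
apply: (@leq_trans (B * (d %/ B).+1)).
  by rewrite leq_mul2l (leq_trans (leq_imset_card _ _)) ?orbT // cardsT card_ord.
rewrite mulnS leq_add2l mulnC; exact: leq_trunc_div.
Qed.

(** Walks project to [g]. Since edges lift uniquely, a backtrack of the projection would already be
    one in the split graph. *)
Lemma split_no_short_closed l : no_short_closed g l -> no_short_closed split_graph l.
Proof.
move=> girth d ds hd pds sz; pose pr (f : W * W) : V * V := (f.1.1, f.2.1).
have prP : path (nb g) (pr d) (map pr ds).
  rewrite path_map; move: hd pds; clear; elim: ds d => //= f ds IHds d hd /andP[].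
  case/and3P=> /eqP fd nf hf pds; rewrite IHds // andbT /nb /pr /= fd eqxx.
  case/and3P: (hf) => gf /eqP f1 /eqP f2; rewrite -fd gf andbT.
  case/and3P: hd => _ /eqP d1 /eqP d2; apply: contra nf => /eqP eq1.
  by apply/eqP; case: f d f1 f2 d1 d2 fd eq1 {hf pds gf} => [[a1 a2] [b1 b2]] [[p1 p2] [q1 q2]] /=
    -> -> -> -> [-> _] ->.
have := girth (pr d) (map pr ds); rewrite size_map last_map => /(_ _ prP sz).
case/and3P: (hd) => gd _ _ => /(_ gd); apply: contra => /eqP lastE.
by rewrite /pr /= lastE.
Qed.

(** Take a copy in [S] of a leaf of the projected set: its neighbours project injectively, as
    adjacency determines which copy is used. *)
Lemma leafy_split (e : rel V) (h : rel W) : subrel h split_graph ->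
  (forall v w, h v w -> e v.1 w.1) -> leafy e -> leafy h.
Proof.
move=> hs he leafy_e S /set0Pn[v0 v0S].
have [|x /imsetP[v vS xE] leaf] := leafy_e [set v.1 | v in S].
  by apply/set0Pn; exists v0.1; apply: imset_f.
exists v => //; apply: leq_trans leaf; rewrite -(card_in_imset (f := fst) (D := [set w in S | h v w])).
  apply: subset_leq_card; apply/subsetP => y /imsetP[w]; rewrite !inE => /andP[wS hvw] ->.
  by rewrite xE he // andbT imset_f.
move=> w w'; rewrite !inE => /andP[_ /hs/and3P[_ _ /eqP w2]] /andP[_ /hs/and3P[_ _ /eqP w2']] eqw.
by case: w w' w2 w2' eqw => [y j] [y' j'] /= -> -> ->.
Qed.

End Splitting.

(** * Coupling colours with the random subgraph *)

Section RandomColours.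
Variables (R : realType) (V : finType) (g : rel V) (p p1 : R).
Hypothesis p1_ge0 : 0 <= p1.
Hypothesis p1_le : p1 <= p.
Hypothesis p_le1 : p <= 1.

Definition colour_law (c : 'I_3) : R := nth 0 [:: 1 - p; p1; p - p1] c.
Definition closed_colour : 'I_3 := @Ordinal 3 0 isT.
Definition first_round : 'I_3 := @Ordinal 3 1 isT.
Definition second_round : 'I_3 := @Ordinal 3 2 isT.

Lemma colour_law_ge0 c : 0 <= colour_law c.
Proof. by case: c => -[|[|[|]]] //= i; rewrite /colour_law /= ?subr_ge0. Qed.

Lemma colour_law_sum1 : \sum_c colour_law c = 1.
Proof. by rewrite !big_ord_recl big_ord0 /colour_law /=; ring. Qed.

Lemma colour_law_open : \sum_(c | c != closed_colour) colour_law c = p.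
Proof. by rewrite big_mkcond !big_ord_recl big_ord0 /colour_law /=; ring. Qed.

Lemma colour_law_closed : \sum_(c | c == closed_colour) colour_law c = 1 - p.
Proof. by rewrite big_pred1_eq. Qed.

Definition open_edges (om : {ffun {set V} -> 'I_3}) : {set {set V}} :=
  [set e in edges g | om e != closed_colour].

(** Colourings are grouped by their set of open edges. Each edge contributes p or 1 - p, and the
    coordinates that are not edges are unconstrained and sum to 1. *)
Lemma subgraph_prob_expect (A : rel V -> Prop) : subgraph_prob g p A =
  expect colour_law (fun om => `[< A (spanning_subgraph (open_edges om)) >]%:R).
Proof.
rewrite /expect (partition_big open_edges (mem (powerset (edges g)))) /=; last first.
  by move=> om _; rewrite inE; apply/subsetP => e; rewrite inE => /andP[].
rewrite /subgraph_prob big_mkcondr /=; apply: eq_bigr => F; rewrite inE => /subsetP Fg.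
rewrite (eq_bigr (fun om => weight colour_law om * `[< A (spanning_subgraph F) >]%:R)); last first.
  by move=> om /eqP ->.
rewrite -mulr_suml; case: ifP => _; last by rewrite mulr0.
pose Q (e : {set V}) : pred 'I_3 := fun c => (e \in edges g) ==> ((e \in F) == (c != closed_colour)).
rewrite mulr1 (eq_bigl (fun om => om \in family Q)); last first.
  move=> om; apply/eqP/familyP => [omF e|omQ].
    by rewrite unfold_in /Q -omF inE; case: (e \in edges g) => //=.
  apply/setP => e; have := omQ e; rewrite unfold_in /Q => /implyP eQ; rewrite inE.
  have [eg|eg] /= := boolP (e \in edges g); first by rewrite (eqP (eQ eg)).
  by apply/esym; apply: contraNF eg => /Fg.
rewrite weight_sum /subgraph_weight big_mkcond /=; apply: eq_bigr => e _.
rewrite /Q; case: ifP => eg /=; last by rewrite colour_law_sum1.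
case: ifP => eF.
  by rewrite -[LHS]colour_law_open; apply: eq_bigl => c; case: (c == closed_colour).
by rewrite -[LHS]colour_law_closed; apply: eq_bigl => c; case: (c == closed_colour).
Qed.

(** Disjoint edge sets are fully open independently, each with probability at least p^l. *)
Lemma many_circuits_prob l (r : seq {set {set V}}) : uniq r ->
  {in r &, forall E E' : {set {set V}}, E != E' -> [disjoint E & E']} ->
  {in r, forall E : {set {set V}}, [/\ (#|E| <= l)%N, E \subset edges g &
    forall F : {set {set V}}, E \subset F -> contains_circuit (spanning_subgraph F)]} ->
  expect colour_law (fun om => (~~ `[< contains_circuit (spanning_subgraph (open_edges om)) >])%:R)
    <= (1 - p ^+ l) ^+ size r.
Proof.
move=> ur dis rP; have p0 : 0 <= p := le_trans p1_ge0 p1_le.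
pose all_open (E : {set {set V}}) (om : {ffun {set V} -> 'I_3}) : R :=
  \prod_(e <- enum E) (om e != closed_colour)%:R.
have all_open01 E om : 0 <= all_open E om <= 1.
  apply/andP; split; first by apply: prodr_ge0 => e _; rewrite ler0n.
  by apply: prodr_ile1 => e _; case: (_ != _); rewrite ?lexx ?ler01.
apply: (@le_trans _ _ (expect colour_law (fun om => \prod_(E <- r) (1 - all_open E om)))).
  apply: le_expect => [|om]; first exact: colour_law_ge0.
  have [_|nocirc] := asboolP (contains_circuit _).
    by apply: prodr_ge0 => E _; rewrite subr_ge0; case/andP: (all_open01 E om).
  rewrite big_seq big1 // => E Er; have [_ Eg EF] := rP _ Er.
  have [e eE ec] : exists2 e, e \in E & om e == closed_colour.
    apply: contrapT => none; apply: nocirc; apply: EF; apply/subsetP => e eE.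
    rewrite inE (subsetP Eg) //=; apply/negP => ec; apply: none; by exists e.
  rewrite /all_open (big_rem e) /= ?mem_enum // ec mul0r subr0 //.
rewrite (@expect_prod _ _ _ _ colour_law_sum1 _ _ _ id) //; last first.
  move=> E Er om om' eqom; congr (1 - _); rewrite /all_open big_seq [RHS]big_seq.
  by apply: eq_bigr => e; rewrite mem_enum => eE; rewrite eqom.
have -> : (1 - p ^+ l) ^+ size r = \prod_(E <- r) (1 - p ^+ l).
  by rewrite big_const_seq count_predT iter_mulr_1.
rewrite big_seq [leRHS]big_seq.
apply: ler_prod => E Er; have [El _ _] := rP _ Er.
have -> : expect colour_law (fun om => 1 - all_open E om) = 1 - p ^+ #|E|.
  rewrite expectB expect_cst ?colour_law_sum1 //; congr (1 - _).
  rewrite (@expect_prod _ _ _ _ colour_law_sum1 _ _ _ (fun e => [set e])) ?enum_uniq //.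
  - rewrite (eq_bigr (fun=> p)); last first.
      move=> e _; rewrite (expect_coord colour_law_sum1 e (fun c => (c != closed_colour)%:R)).
      rewrite -colour_law_open [RHS]big_mkcond; apply: eq_bigr => c _.
      by case: (c != closed_colour); rewrite ?mulr1 ?mulr0.
    by rewrite big_const_seq count_predT -cardE /= iter_mulr_1.
  - by move=> e _ om om' eqom; rewrite eqom // inE.
  - by move=> e e' _ _ ee'; rewrite disjoints1 inE.
rewrite subr_ge0 exprn_ile1 //= lerD2l lerN2.
by apply: ler_wiXn2l.
Qed.

End RandomColours.

(** * Reduction to the dense core and choice of parameters *)

Lemma no_short_closed_sub (W : finType) (h h0 : rel W) l :
  subrel h h0 -> no_short_closed h0 l -> no_short_closed h l.
Proof.
move=> sub girth d ds hd pds; apply: girth; first exact: sub.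
by apply: sub_path pds => f f' /and3P[fE nf hf]; rewrite /nb fE nf sub.
Qed.

Lemma exists_nat_ge (R : realType) (x : R) : exists n : nat, x <= n%:R.
Proof.
by exists (Num.bound `|x|); apply: le_trans (ler_norm x) (ltW (archi_boundP (normr_ge0 _))).
Qed.

(** Since (1 - q)^K (1 + K q) <= 1, any K >= 1 / (e q) suffices. *)
Lemma exists_pow_compl_le (R : realType) (q e : R) : 0 < q <= 1 -> 0 < e ->
  exists K : nat, (1 - q) ^+ K <= e.
Proof.
case/andP=> q0 q1 e0; have [K leK] := exists_nat_ge (e^-1 / q); exists K.
have := @prod_compl_le R 'I_K xpredT (fun=> q); rewrite (ltW q0) q1 => /(_ (fun _ _ => isT)).
rewrite prodr_const sumr_const card_ord -[q *+ _]mulr_natr.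
have : e^-1 <= q * K%:R by rewrite mulrC -ler_pdivrMr.
set x := (1 - q) ^+ K; have x0 : 0 <= x by rewrite exprn_ge0 // subr_ge0.
move=> le1 le2; have : x * e^-1 <= 1.
  by apply: le_trans le2; rewrite ler_wpM2l //; lra.
by rewrite ler_pdivrMr // mul1r.
Qed.

(** The graph [g1] is split and its dense core taken. Of the darts of [g1], a fraction m / mu1 pays
    for the original vertices and theta / 2 for the extra copies, so at least a fraction theta / 2
    survives in [h]. *)
Lemma no_circuit_prob_le (R : realType) (V : finType) (g : rel V) (D : {set {set V}})
    (p p1 m mu1 delta : R) (B k : nat) :
  let g1 := delete_edges D g in
  let c := delta * ln (p1 * (m - 1)) ^+ 2 / B%:R ^+ 3 in
  let theta := 1 - m / mu1 in
  symmetric g -> irreflexive g -> 0 < p1 -> 0 < delta -> p1 + delta <= p -> p <= 1 ->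
  2 < m -> 1 < p1 * (m - 1) -> m < mu1 -> (0 < B)%N -> m / B%:R <= theta / 2 ->
  short_circuit_free (2 * k + 2) g1 -> (1 < k)%N -> 2 <= k%:R * c ->
  (0 < #|V|)%N -> mu1 * #|V|%:R <= #|darts g1|%:R ->
  expect (colour_law p p1)
    (fun om => (~~ `[< contains_circuit (spanning_subgraph (open_edges g om)) >])%:R) <=
  4 * (overlap_bound k B)%:R / (c ^+ 2 * (theta / 2 * mu1 * #|V|%:R)).
Proof.
move=> g1 c theta sym_g irr_g p10 d0 p1p ple1 m2 sup mmu B0 mB free k1 kc V0 dens.
have sym_g1 : symmetric g1 by apply: delete_edges_sym.
have irr_g1 : irreflexive g1 by move=> x; rewrite /g1 /delete_edges irr_g.
have girth1 := short_circuit_free_nb sym_g1 irr_g1 free.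
set h0 := split_graph g1 B.
have sym_h0 : symmetric h0 by apply: split_graph_sym.
have irr_h0 : irreflexive h0 by apply: split_graph_irr.
have [h [sym_h sub_h deg2 avg many]] :=
  dense_core sym_h0 irr_h0 m2 (@split_vertices_darts _ g1 B).
have irr_h : irreflexive h by move=> v; apply/negP => /sub_h; rewrite irr_h0.
have Bp : 0 < B%:R :> R by rewrite ltr0n.
have mu1p : 0 < mu1 by lra.
have theta0 : 0 < theta by rewrite subr_gt0 ltr_pdivrMr // mul1r.
have Vp : 0 < #|V|%:R :> R by rewrite ltr0n.
set M1 : R := #|darts g1|%:R in dens *.
have M10 : 0 < M1 by apply: lt_le_trans dens; rewrite mulr_gt0.
have manyh : theta / 2 * mu1 * #|V|%:R <= #|darts h|%:R.
  apply: le_trans many; rewrite card_darts_split -/M1.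
  have : m * #|split_vertices g1 B|%:R <= m / B%:R * M1 + m / mu1 * M1.
    have : B%:R * #|split_vertices g1 B|%:R <= B%:R * #|V|%:R + M1.
      by rewrite -!natrM -natrD ler_nat card_split_vertices.
    move=> le1.
    have le2 : #|split_vertices g1 B|%:R <= #|V|%:R + M1 / B%:R.
      by rewrite -(ler_pM2l Bp) mulrDr mulrCA mulfV ?gt_eqF // mulr1.
    have le3 : #|V|%:R <= M1 / mu1 by rewrite ler_pdivlMr // mulrC.
    have -> : m / B%:R * M1 + m / mu1 * M1 = m * (M1 / mu1 + M1 / B%:R) by ring.
    rewrite ler_pM2l; last by lra.
    by apply: le_trans le2 _; rewrite lerD2r.
  have : m / B%:R * M1 <= theta / 2 * M1 by rewrite ler_pM2r.
  have : theta / 2 * (mu1 * #|V|%:R) <= theta / 2 * M1 by rewrite ler_pM2l // divr_gt0.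
  have : theta * M1 + m / mu1 * M1 = M1 by rewrite -mulrDl subrK mul1r.
  lra.
have Xp : 0 < theta / 2 * mu1 * #|V|%:R by rewrite !mulr_gt0 ?invr_gt0.
have dh0 : (0 < #|darts h|)%N by rewrite -(ltr0n R); apply: lt_le_trans manyh.
have eta0 : 0 < ln (p1 * (m - 1)) by rewrite ln_gt0.
have c0 : 0 < c by rewrite !(mulr_gt0, divr_gt0, exprn_gt0, invr_gt0).
have p1lep : p1 <= p by lra.
have lab_inj v w v' w' : h v w -> h v' w' -> split_edge v w = split_edge v' w' ->
    (v, w) = (v', w') \/ (v, w) = (w', v').
  by move=> /sub_h hvw /sub_h hvw'; apply: split_edge_inj hvw hvw'.
have degB v : (#|[set w | h v w]| <= B)%N.
  apply: leq_trans (split_graph_deg g1 B0 v).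
  by apply: subset_leq_card; apply/subsetP => w; rewrite !inE => /sub_h.
have dc2 : delta <= colour_law p p1 second_round by rewrite /colour_law /=; lra.
have law0 := colour_law_ge0 (ltW p10) p1lep ple1.
have main := @leafy_prob_le R _ _ _ h (@split_edge V) (colour_law p p1) first_round second_round
  (2 * k + 2) k B m delta sym_h irr_h (@split_edgeC V) lab_inj law0
  (colour_law_sum1 p p1) isT
  (no_short_closed_sub sub_h (split_no_short_closed (B := B) girth1)) (leqnn _) k1 degB deg2
  (ltW m2) p10 sup avg d0 dc2 dh0 kc.
apply: (@le_trans _ _ (4 * (overlap_bound k B)%:R / (c ^+ 2 * #|darts h|%:R))); last first.
  have c20 : 0 < c ^+ 2 by apply: exprn_gt0.
  have P1 : 0 < c ^+ 2 * #|darts h|%:R by apply: mulr_gt0; rewrite ?ltr0n.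
  have P2 : 0 < c ^+ 2 * (theta / 2 * mu1 * #|V|%:R) by apply: mulr_gt0.
  apply: ler_wpM2l; first by rewrite mulr_ge0.
  by rewrite lef_pV2 ?posrE // ler_pM2l.
apply: le_trans main; apply: le_expect => // om.
have [_|nocirc] := asboolP (contains_circuit _); first by rewrite ler0n.
rewrite ler_nat lt0b; apply/asboolP.
(* Edges of [h] with a first- or second-round colour project to open edges of [g]. *)
apply: (@leafy_split V g1 B (spanning_subgraph (open_edges g om))).
- by move=> v w /andP[/sub_h].
- move=> v w /andP[/sub_h/and3P[/andP[gvw _] _ _] col].
  rewrite /spanning_subgraph inE edgesE // gvw /=.
  by case/orP: col => /eqP; rewrite /split_edge => ->.
- apply: no_circuit_leafy => //.
  + by move=> x y; rewrite /spanning_subgraph setUC.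
  + by move=> x; rewrite /spanning_subgraph inE edgesE // irr_g.
Qed.

Theorem theorem1p1 (R : realType) (eps mu : R) (heps : 0 < eps) (hmu : 2 < mu) :
  exists N : nat,
    forall (V : finType) (g : rel V) (p : R),
      symmetric g -> irreflexive g ->
      (N <= #|V|)%N ->
      mu <= average_degree g R ->
      1 / (mu - 1) + eps <= p -> p <= 1 ->
      1 - eps <= subgraph_prob g p (@contains_circuit V).
Proof.
(* Half of the margin eps is kept for the second round. If [p1] >= 1, no admissible p exists. *)
pose p1 := 1 / (mu - 1) + eps / 2.
have [p1lt|p1ge] := ltP p1 1; last first.
  by exists 0%N => V g p _ _ _ _ pge ple; rewrite /p1 in p1ge; lra.
have mu10 : 0 < mu - 1 by lra.
have p10 : 0 < p1 by rewrite /p1 addr_gt0 // divr_gt0.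
(* [m] lies between the critical value 1 + 1/p1 and mu; [mu1], between [m] and mu, leaves room for
   the deleted edges. *)
pose m := (1 + p1^-1 + mu) / 2; pose mu1 := (m + mu) / 2.
have p1mu : p1 * (mu - 1) = 1 + eps / 2 * (mu - 1).
  by rewrite /p1; field; rewrite gt_eqF.
have p1i : p1 * p1^-1 = 1 by rewrite mulfV ?gt_eqF.
have p1i1 : 1 < p1^-1 by rewrite invf_gt1.
have p1imu : p1^-1 < mu - 1.
  rewrite -(ltr_pM2l p10) p1i p1mu ltrDl mulr_gt0 // divr_gt0 //.
have m2 : 2 < m by rewrite /m; lra.
have mmu : m < mu by rewrite /m; lra.
have mmu1 : m < mu1 by rewrite /mu1; lra.
have mu1mu : mu1 < mu by rewrite /mu1; lra.
have mu1p : 0 < mu1 by lra.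
have sup : 1 < p1 * (m - 1).
  by rewrite -[ltLHS]p1i ltr_pM2l // /m; lra.
pose theta := 1 - m / mu1.
have theta0 : 0 < theta by rewrite subr_gt0 ltr_pdivrMr // mul1r.
have [B' leB'] := exists_nat_ge (m / (theta / 2)); pose B := B'.+1.
have Bp : 0 < B%:R :> R by rewrite ltr0n.
have leB : m / B%:R <= theta / 2.
  rewrite ler_pdivrMr // mulrC -ler_pdivrMr ?divr_gt0 // (le_trans leB') //.
  by rewrite ler_nat leqnSn.
have eta0 : 0 < ln (p1 * (m - 1)) by rewrite ln_gt0.
pose c := eps / 2 * ln (p1 * (m - 1)) ^+ 2 / B%:R ^+ 3.
have c0 : 0 < c by rewrite !(mulr_gt0, divr_gt0, exprn_gt0, invr_gt0).
(* Adding 2 ensures k > 1; the girth needed is then governed by 2 k + 2. *)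
have [k' lek'] := exists_nat_ge (2 / c); pose k := k'.+2.
have kc : 2 <= k%:R * c.
  by rewrite -ler_pdivrMr // (le_trans lek') // ler_nat /k -addn2 leq_addr.
pose l := (2 * k + 2)%N.
have [||K leK] := @exists_pow_compl_le R (p1 ^+ l) eps; [|exact: heps|].
  by rewrite exprn_gt0 //= exprn_ile1 // ltW.
(* From [N1] vertices on, deleting K l edges keeps the average degree at least [mu1]; from [N2] on,
   the second-moment bound is at most eps. *)
have [N1 leN1] := exists_nat_ge ((2 * (K * l))%:R / (mu - mu1)).
have [N2 leN2] := exists_nat_ge
  (4 * (overlap_bound k B)%:R / (c ^+ 2 * (theta / 2 * mu1)) / eps).
exists (maxn 1 (maxn N1 N2)) => V g p sym_g irr_g; rewrite !geq_max.
case/and3P=> V0 VN1 VN2 avg pge ple.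
have Vp : 0 < #|V|%:R :> R by rewrite ltr0n.
have p1p : p1 + eps / 2 <= p by rewrite /p1; lra.
have p1lep : p1 <= p by lra.
suff nocirc : expect (colour_law p p1)
    (fun om => (~~ `[< contains_circuit (spanning_subgraph (open_edges g om)) >])%:R) <= eps.
  rewrite (subgraph_prob_expect g p p1) lerBlDr -lerBlDl; apply: le_trans nocirc.
  rewrite -[X in X - _](expect_cst {set V} (colour_law_sum1 p p1)) -expectB le_eqVlt; apply/orP; left.
  apply/eqP; apply: eq_expect => om; case: (`[< _ >]); rewrite /= ?subrr ?subr0 //.
have [[r [ur szr dis rP]]|[D leD free]] := short_circuits_packing l K sym_g.
  apply: le_trans (many_circuits_prob (ltW p10) p1lep ple ur dis rP) _.
  rewrite szr; apply: le_trans leK; rewrite lerXn2r ?nnegrE ?subr_ge0 ?exprn_ile1 ?(ltW p10) ?(ltW p1lt) //.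
    exact: le_trans (ltW p10) p1lep.
  by rewrite lerD2l lerN2 lerXn2r ?nnegrE ?(ltW p10) // (le_trans (ltW p10)).
have dens : mu1 * #|V|%:R <= #|darts (delete_edges D g)|%:R.
  have dg : mu * #|V|%:R <= #|darts g|%:R.
    by move: avg; rewrite /average_degree ler_pdivlMr // card_darts natr_sum.
  have le1 : #|darts g|%:R <= #|darts (delete_edges D g)|%:R + (2 * (K * l))%:R :> R.
    rewrite -natrD ler_nat (leq_trans (card_darts_delete D sym_g)) // leq_add2l.
    by rewrite leq_mul2l leD.
  have le2 : (2 * (K * l))%:R <= (mu - mu1) * #|V|%:R :> R.
    rewrite mulrC -ler_pdivrMr ?subr_gt0 // (le_trans leN1) // ler_nat //.
  lra.
have eps20 : 0 < eps / 2 by rewrite divr_gt0.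
apply: le_trans (no_circuit_prob_le sym_g irr_g p10 eps20 p1p ple m2 sup mmu1 (ltn0Sn B') leB
  free (isT : (1 < k)%N) kc V0 dens) _.
rewrite -/c -/theta; set Q := 4 * _ in leN2 *.
have cp : 0 < c ^+ 2 * (theta / 2 * mu1) by apply: mulr_gt0; [apply: exprn_gt0|apply: mulr_gt0 => //; apply: divr_gt0].
have -> : c ^+ 2 * (theta / 2 * mu1 * #|V|%:R) = c ^+ 2 * (theta / 2 * mu1) * #|V|%:R by rewrite mulrA.
rewrite ler_pdivrMr; last exact: mulr_gt0.
have := le_trans leN2 (_ : N2%:R <= #|V|%:R :> R); rewrite ler_nat => /(_ VN2).
rewrite ler_pdivrMr // ler_pdivrMr // => le1.
by rewrite mulrA (mulrC _ #|V|%:R) mulrA.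
Qed.
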